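(* Consider the linear Gaussian state-space model $x_k=A_kx_{k-1}+q_k$ ($k=1,\dots,T$), $y_k=C_kx_k+r_k$ ($k=0,\dots,T$), with independent white Gaussian noises $q_k\sim\mathcal{N}(0,Q_k)$, $r_k\sim\mathcal{N}(0,R_k)$ and $x_0\sim\mathcal{N}(0,P_0)$ independent of them. Let $Y_0^T=(y_0,\dots,y_T)$ and let $(J_0^T,Y_0^T)$, $J_0^T=(J_0,\dots,J_T)$, be jointly distributed with finite second moments such that, for every $k\in\{0,\dots,T\}$ and every $n\ge1$ with $k+n\le T$, $J_k$ is conditionally independent of $y_{k+n}$ given $Y_0^k=(y_0,\dots,y_k)$. Then $\mathbb{E}[J_k\mathcal{I}_{k+n}^\top]=0$ for all such $k,n$.
   Context: The innovation process is $\mathcal{I}_k=y_k-C_k\hat x^*_{k|k-1}$ with $\hat x^*_{k|k-1}=\mathbb{E}[x_k\mid y_0,\dots,y_{k-1}]$, and $\mathcal{I}_0=y_0$. *)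

(* Defs.v *)
From HB Require Import structures.
From mathcomp Require Import all_boot all_order all_algebra.
From mathcomp Require Import all_classical all_reals all_analysis.
Set Implicit Arguments. Unset Strict Implicit. Unset Printing Implicit Defensive.
Import Order.TTheory GRing.Theory Num.Theory.
Local Open Scope classical_set_scope.
Local Open Scope ring_scope.

Section defs.
Context {d : measure_display} {Omega : measurableType d} {R : realType}.
Variable P : probability Omega R.

Definition rcoord {n} (X : Omega -> 'cV[R]_n) (i : 'I_n) : Omega -> R :=
  fun w => X w i 0.

Definition rvec {n} (X : Omega -> 'cV[R]_n) : Prop :=
  forall i, measurable_fun setT (rcoord X i).

Definition sigma_rv {n} (X : Omega -> 'cV[R]_n) : set (set Omega) :=
  <<s \bigcup_(i in [set: 'I_n]) preimage_set_system setT (rcoord X i) measurable >>.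

Definition sigma_past {n} (y : nat -> Omega -> 'cV[R]_n) (k : nat) : set (set Omega) :=
  <<s \bigcup_(j in [set j | (j <= k)%N])
        \bigcup_(i in [set: 'I_n]) preimage_set_system setT (rcoord (y j) i) measurable >>.

Definition is_cond_exp (G : set (set Omega)) (X Z : Omega -> R) : Prop :=
  (forall B : set R, measurable B -> G (Z @^-1` B)) /\
  P.-integrable setT (fun w => (Z w)%:E) /\
  forall A, G A -> (\int[P]_(w in A) (Z w)%:E = \int[P]_(w in A) (X w)%:E)%E.

Definition is_cond_expv {n} (G : set (set Omega)) (X Z : Omega -> 'cV[R]_n) : Prop :=
  forall i, is_cond_exp G (rcoord X i) (rcoord Z i).

Definition cond_indep (F1 F2 G : set (set Omega)) : Prop :=
  forall A B, F1 A -> F2 B ->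
  forall ZA ZB ZAB : Omega -> R,
    is_cond_exp G (\1_A) ZA -> is_cond_exp G (\1_B) ZB ->
    is_cond_exp G (\1_(A `&` B)) ZAB ->
    {ae P, forall w, ZAB w = ZA w * ZB w}.

Definition mutually_independent (I : eqType) (D : set I)
    (F : I -> set (set Omega)) : Prop :=
  forall s : seq I, uniq s -> (forall i, i \in s -> D i) ->
  forall E : I -> set Omega, (forall i, i \in s -> F i (E i)) ->
  P (\bigcap_(i in [set` s]) E i) = (\prod_(i <- s) P (E i))%E.

Definition gaussian0 {n} (X : Omega -> 'cV[R]_n) (S : 'M[R]_n) : Prop :=
  S^T = S /\
  forall a : 'cV[R]_n,
    let v := (a^T *m S *m a) 0 0 in
    0 <= v /\
    forall B : set R, measurable B ->
      P ((fun w => (a^T *m X w) 0 0) @^-1` B) =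
      (if v == 0 then \d_(0:R) B else normal_prob 0 (Num.sqrt v) B).

(** innovation I_k = y_k - C_k xhat, with xhat a version of E[x_k | Y_0^{k-1}] *)
Definition innovation {nx ny} (y : nat -> Omega -> 'cV[R]_ny) (C : nat -> 'M[R]_(ny, nx))
  (k : nat) (xhat : Omega -> 'cV[R]_nx) : Omega -> 'cV[R]_ny :=
  fun w => y k w - C k *m xhat w.

End defs.

(** noise index: (0,0) = x_0, (1,k) = q_k, (2,k) = r_k *)
Definition noise_index (T : nat) : set (nat * nat) :=
  [set p | p = (0%N, 0%N) \/ (p.1 = 1%N /\ (1 <= p.2 <= T)%N) \/ (p.1 = 2%N /\ (p.2 <= T)%N)].

(* Main.v *)
(** States and observations are linear combinations of the independent noises,
    and each such combination has characteristic function [exp (- v / 2)], with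
    [v] a quadratic form in its coefficients.  If [Z] is orthogonal to [W] for
    this form then [s Z + W] and [s Z - W] have equal characteristic functions
    at 1; as [s] tends to 0 this gives [E[Z cos W] = 0].  Hence [Z] integrates
    to 0 over every event generated by the [W] orthogonal to it, and
    conditional expectations given past observations are orthogonal
    projections for the form.

    Consequently the innovation is almost surely a linear combination of
    [y_0, ..., y_{k+n}] that is orthogonal to [y_0, ..., y_k].  Conditional
    independence gives [E[J_k y_l] = E[J_k E[y_l | Y_0^k]]] for each [l]
    separately; by linearity [E[J_k I_{k+n}]] is [E[J_k L]], where [L] is the
    projection of the innovation on [y_0, ..., y_k], which vanishes. *)

Require Import Defs.
From HB Require Import structures.
From mathcomp Require Import all_boot all_order all_algebra.
From mathcomp Require Import all_classical all_reals all_analysis.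
From mathcomp Require Import measurable_realfun ring lra.
Import Order.TTheory GRing.Theory Num.Theory.
Import numFieldNormedType.Exports.
Local Open Scope classical_set_scope.
Local Open Scope ring_scope.

Set Implicit Arguments. Unset Strict Implicit. Unset Printing Implicit Defensive.

(** Two obstacles shape the proof. [J] is not assumed Gaussian, so [E[J_k L]] cannot be read off a
    covariance form; [J_k] enters only as a multiplier adapted to its own sigma-algebra. The
    covariances may be singular, so there is no joint density to compute with and the form is only
    semidefinite: this is why the argument uses characteristic functions and projections that
    tolerate isotropic vectors. The step from [E[Z cos W] = 0] to events rests on an algebra.
    Products of cosines are sums of cosines, so trigonometric polynomials in the [W] are stable
    under polynomials; iterating the cubic [(3 x - x ^ 3) / 2] drives a bounded one to its sign.
    Thus the indicator of [f < 0] is a bounded pointwise limit of trigonometric polynomials, and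
    such events form a pi-system generating the sigma-algebra of the [W]. Conditional independence
    is a statement on events and arbitrary versions. Versions with values in [[0, 1]] are
    constructed so that their products with integrable variables stay integrable. *)

(** * Real-valued integrals and orthogonality to a sigma-algebra *)

Section integration.
Context {d : measure_display} {Omega : measurableType d} {R : realType}.
Variable P : {finite_measure set Omega -> \bar R}.
Implicit Types (f g : Omega -> R) (D : set (set Omega)).

Definition summable f := P.-integrable setT (EFin \o f).
Definition Ex f : R := \int[P]_w f w.

Lemma summable_meas f : summable f -> measurable_fun setT f.
Proof. by move=> /integrableP[/measurable_EFinP]. Qed.

Lemma le_summable f g : measurable_fun setT f -> summable g ->
  (forall w, `|f w| <= `|g w|) -> summable f.
Proof.
move=> mf ig fg; apply: (le_integrable measurableT _ _ ig).
  exact/measurable_EFinP.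
by move=> w _; rewrite /= lee_fin.
Qed.

Lemma summable_cst c : summable (fun=> c).
Proof. exact: finite_measure_integrable_cst. Qed.

Lemma summable_bounded f M : measurable_fun setT f ->
  (forall w, `|f w| <= M) -> summable f.
Proof.
move=> mf fM; apply: (le_summable mf (summable_cst M)) => w.
exact: le_trans (fM w) (ler_norm _).
Qed.

Lemma summableMl f g M : measurable_fun setT f ->
  (forall w, `|f w| <= M) -> summable g -> summable (fun w => f w * g w).
Proof.
move=> mf fM ig; have ig' : summable (fun w => M * g w).
  exact: (integrableZl _ _ ig).
apply: (le_summable _ ig').
  by apply: measurable_funM => //; exact: summable_meas.
by move=> w; rewrite !normrM ler_wpM2r// (le_trans (fM w))// ler_norm.
Qed.

Lemma summableMr f g M : measurable_fun setT f ->
  (forall w, `|f w| <= M) -> summable g -> summable (fun w => g w * f w).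
Proof.
by move=> mf fM /(summableMl mf fM); under eq_fun do rewrite mulrC.
Qed.

Lemma summableD f g : summable f -> summable g ->
  summable (fun w => f w + g w).
Proof. by move=> sf sg; exact: (integrableD _ sf sg). Qed.

Lemma summableZ c f : summable f -> summable (fun w => c * f w).
Proof. by move=> sf; exact: (integrableZl _ _ sf). Qed.

Lemma summableB f g : summable f -> summable g ->
  summable (fun w => f w - g w).
Proof. by move=> sf sg; exact: (integrableB _ sf sg). Qed.

Lemma summable_sum (I : Type) (s : seq I) (F : I -> Omega -> R) :
  (forall i, summable (F i)) -> summable (fun w => \sum_(i <- s) F i w).
Proof.
move=> sF; elim: s => [|i s IH].
  by under eq_fun do rewrite big_nil; exact: summable_cst.
by under eq_fun do rewrite big_cons; exact: summableD.
Qed.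

Lemma summable_mul f g : measurable_fun setT f -> measurable_fun setT g ->
  summable (fun w => f w ^+ 2) -> summable (fun w => g w ^+ 2) ->
  summable (fun w => f w * g w).
Proof.
move=> mf mg sf sg; apply: (le_summable _ (summableD sf sg)).
  exact: measurable_funM.
move=> w; rewrite normrM [leRHS]ger0_norm ?addr_ge0 ?sqr_ge0//.
rewrite -[f w ^+ 2]real_normK ?num_real// -[g w ^+ 2]real_normK ?num_real//.
have := sqr_ge0 (`|f w| - `|g w|).
have := normr_ge0 (f w); have := normr_ge0 (g w).
nra.
Qed.

Lemma summable_sqr f : measurable_fun setT f ->
  summable (fun w => f w ^+ 2) -> summable f.
Proof.
move=> mf sf.
have := @summable_mul f (fun=> 1) mf (measurable_cst _) sf (summable_cst _).
by under eq_fun do rewrite mulr1.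
Qed.

Lemma ExD f g : summable f -> summable g ->
  Ex (fun w => f w + g w) = Ex f + Ex g.
Proof. exact: RintegralD. Qed.

Lemma ExB f g : summable f -> summable g ->
  Ex (fun w => f w - g w) = Ex f - Ex g.
Proof. exact: RintegralB. Qed.

Lemma ExZ c f : summable f -> Ex (fun w => c * f w) = c * Ex f.
Proof. exact: RintegralZl. Qed.

Lemma eq_Ex f g : f =1 g -> Ex f = Ex g.
Proof. by move=> fg; apply: eq_Rintegral => w _. Qed.

Lemma Ex0 : Ex (fun=> 0) = 0.
Proof. by rewrite /Ex Rintegral_cst// mul0r. Qed.

Lemma Ex_sum (I : Type) (s : seq I) (F : I -> Omega -> R) :
  (forall i, summable (F i)) ->
  Ex (fun w => \sum_(i <- s) F i w) = \sum_(i <- s) Ex (F i).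
Proof.
move=> sF; elim: s => [|i s IH].
  by rewrite big_nil -[RHS]Ex0; apply: eq_Ex => w; rewrite big_nil.
rewrite big_cons -IH -ExD//; last exact: summable_sum.
by apply: eq_Ex => w; rewrite big_cons.
Qed.

Lemma Ex_indic f A : measurable A ->
  \int[P]_(w in A) f w = Ex (fun w => f w * \1_A w).
Proof.
move=> mA; rewrite /Ex Rintegral_mkcond; apply: eq_Rintegral => w _.
by rewrite patchE indicE; case: ifPn => _; rewrite ?mulr1 ?mulr0.
Qed.

Lemma normr_indic_le1 (A : set Omega) w : `|\1_A w : R| <= 1.
Proof. by rewrite indicE ger0_norm//; case: (_ \in _). Qed.

Lemma summableM_indic f A : measurable A -> summable f ->
  summable (fun w => f w * \1_A w).
Proof.
move=> mA; apply: (@summableMr \1_A f 1) => //; exact: normr_indic_le1.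
Qed.

Lemma Ex_cvg (f_ : nat -> Omega -> R) f g :
  (forall n, measurable_fun setT (f_ n)) -> measurable_fun setT f ->
  (forall w, f_ ^~ w @ \oo --> f w) -> summable g ->
  (forall n w, `|f_ n w| <= g w) ->
  (fun n => Ex (f_ n)) @ \oo --> Ex f.
Proof.
move=> mf_ mf ff sg fg.
have [|||||i_f _ cv] := @dominated_convergence _ Omega R P setT measurableT
  (fun n => EFin \o f_ n) (EFin \o f) (EFin \o g).
- by move=> n; exact/measurable_EFinP.
- exact/measurable_EFinP.
- by apply: aeW => w _; exact: (cvg_comp _ _ (ff w)).
- exact: sg.
- by apply: aeW => w n _; rewrite /= lee_fin.
apply: fine_cvg; rewrite /= fineK//.
exact: integrable_fin_num.
Qed.

Lemma Ex_lim0 (f_ : nat -> Omega -> R) f g :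
  (forall n, measurable_fun setT (f_ n)) -> measurable_fun setT f ->
  (forall w, f_ ^~ w @ \oo --> f w) -> summable g ->
  (forall n w, `|f_ n w| <= g w) -> (forall n, Ex (f_ n) = 0) -> Ex f = 0.
Proof.
move=> mf_ mf ff sg fg f0.
have := Ex_cvg mf_ mf ff sg fg; under eq_fun do rewrite f0.
by move/(cvg_lim (@Rhausdorff R)) => <-; rewrite lim_cst//; exact: Rhausdorff.
Qed.

(** Says that [g] has conditional expectation 0 given [<<s D>>]. It is linear in [g] and involves no
    choice of version, so the proof works with it rather than with conditional expectations. *)
Definition null_on D g := forall A, <<s D>> A -> Ex (fun w => g w * \1_A w) = 0.

Definition adapted D f := forall B : set R, measurable B -> <<s D>> (f @^-1` B).

(** Retyping the domain as [g_sigma_algebraType D] makes adaptedness ordinary measurability, so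
    closure properties and approximation by simple functions apply to it. *)
Lemma adapted_measurable_fun D f :
  adapted D f <-> measurable_fun setT (f : g_sigma_algebraType D -> R).
Proof.
split=> [af _ B mB|mf B mB]; first by rewrite setTI; exact: af.
by rewrite -[_ @^-1` _]setTI; exact: mf.
Qed.

Lemma adapted_meas D f : D `<=` measurable -> adapted D f ->
  measurable_fun setT f.
Proof.
move=> mD af _ B mB; rewrite setTI; apply: smallest_sub (af _ mB) => //.
exact: sigma_algebra_measurable.
Qed.

Lemma sigma_meas D A : D `<=` measurable -> <<s D>> A -> measurable A.
Proof.
move=> mD; apply: smallest_sub => //; exact: sigma_algebra_measurable.
Qed.

Lemma adapted_indic D A : <<s D>> A -> adapted D (\1_A : Omega -> R).
Proof.
move=> DA; apply/adapted_measurable_fun.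
exact: (@measurable_indic _ (g_sigma_algebraType D)).
Qed.

Lemma adaptedB D f g : adapted D f -> adapted D g -> adapted D (fun w => f w - g w).
Proof.
move=> /adapted_measurable_fun mf /adapted_measurable_fun mg.
by apply/adapted_measurable_fun; exact: measurable_funB.
Qed.

Lemma adapted_lt D g c : adapted D g -> <<s D>> [set w | g w < c].
Proof.
move=> ag; have := ag `]-oo, c[%classic (measurable_itv _).
by congr (<<s D>> _); apply/seteqP; split=> w /=; rewrite in_itv.
Qed.

Lemma adapted_gt D g c : adapted D g -> <<s D>> [set w | c < g w].
Proof.
move=> ag; have := ag `]c, +oo[%classic (measurable_itv _).
by congr (<<s D>> _); apply/seteqP; split=> w /=; rewrite in_itv/= andbT.
Qed.

Import HBNNSimple.

Lemma null_on_nnsfun D g (mD : D `<=` measurable)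
    (h : {nnsfun (g_sigma_algebraType D) >-> R}) :
  summable g -> null_on D g -> Ex (fun w => g w * h w) = 0.
Proof.
move=> sg g0.
have mh r : <<s D>> (h @^-1` [set r]).
  by rewrite -[_ @^-1` _]setTI; apply: (measurable_funP h).
transitivity (Ex (fun w => \sum_(r <- finmap.enum_fset (fset_set (range h)))
    (r * (g w * \1_(h @^-1` [set r]) w)))).
  apply: eq_Ex => w; rewrite (fimfunE h w) fsbig_finite//= mulr_sumr.
  by apply: eq_bigr => r _; rewrite mulrCA.
rewrite Ex_sum => [|r]; last first.
  by apply: summableZ; apply: summableM_indic => //; exact: sigma_meas (mh r).
rewrite big1// => r _; rewrite ExZ ?g0 ?mulr0//.
by apply: summableM_indic => //; exact: sigma_meas (mh r).
Qed.

(** Simple functions adapted to [D] increase to [f]. Since they stay below [f], [|g f|] dominates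
    the products, so [f] may be unbounded. *)
Lemma null_on_ge0 D g f : D `<=` measurable -> summable g -> null_on D g ->
  adapted D f -> (forall w, 0 <= f w) -> summable (fun w => g w * f w) ->
  Ex (fun w => g w * f w) = 0.
Proof.
move=> mD sg g0 af f0 sgf.
have mf : measurable_fun setT (EFin \o f : g_sigma_algebraType D -> \bar R).
  exact/measurable_EFinP/adapted_measurable_fun.
pose h := nnsfun_approx measurableT mf.
have h_ge0 n w : 0 <= h n w by [].
have h_le n w : h n w <= f w.
  by rewrite -lee_fin /h nnsfun_approxE; apply: le_approx => // x _; rewrite lee_fin.
have h_cvg w : (fun n => h n w) @ \oo --> f w.
  rewrite /h; under eq_fun do rewrite nnsfun_approxE.
  apply: (@cvg_approx _ (g_sigma_algebraType D) R setT (EFin \o f) w) => //.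
    by move=> x _; rewrite lee_fin.
  exact: ltry.
have mh n : measurable_fun setT (h n : Omega -> R).
  apply: (adapted_meas mD); apply/adapted_measurable_fun.
  exact: measurable_funP.
apply: (@Ex_lim0 (fun n w => g w * h n w) _ (fun w => `|g w * f w|)).
- move=> n; apply: measurable_funM => //; exact: summable_meas.
- exact: summable_meas.
- by move=> w; apply: cvgM; [exact: cvg_cst|exact: h_cvg].
- exact: integrable_norm.
- by move=> n w; rewrite !normrM ler_wpM2l// !ger0_norm.
- by move=> n; exact: null_on_nnsfun.
Qed.

(** The standard way of using [null_on]: orthogonality to events becomes orthogonality to every
    adapted multiplier whose product with [g] is integrable. Both [g f^+] and [g f^-] are dominated
    by [g f]. *)
Lemma null_on_adapted D g f : D `<=` measurable -> summable g -> null_on D g ->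
  adapted D f -> summable (fun w => g w * f w) ->
  Ex (fun w => g w * f w) = 0.
Proof.
move=> mD sg g0 /adapted_measurable_fun af sgf.
have mf : measurable_fun setT f by exact/(adapted_meas mD)/adapted_measurable_fun.
have s1 : summable (fun w => g w * f^\+ w).
  apply: (le_summable _ sgf) => [|w].
    by apply: measurable_funM; [exact: summable_meas|exact: measurable_funrpos].
  rewrite !normrM ler_wpM2l// /funrpos/=.
  by have [//|_] := leP 0 (f w); rewrite normr0.
have s2 : summable (fun w => g w * f^\- w).
  apply: (le_summable _ sgf) => [|w].
    by apply: measurable_funM; [exact: summable_meas|exact: measurable_funrneg].
  rewrite !normrM ler_wpM2l// /funrneg/=.
  have [f0|f0] := leP 0 (f w); first by rewrite max_r ?normr0// oppr_le0.
  by rewrite max_l ?normrN// oppr_ge0 ltW.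
transitivity (Ex (fun w => g w * f^\+ w - g w * f^\- w)).
  apply: eq_Ex => w; rewrite -mulrBr; congr (_ * _).
  rewrite /funrpos /funrneg; have [f0|f0] := leP 0 (f w).
    by rewrite max_r ?subr0// oppr_le0.
  by rewrite max_l ?sub0r ?opprK// oppr_ge0 ltW.
rewrite ExB// (null_on_ge0 mD sg g0 _ _ s1) ?(null_on_ge0 mD sg g0 _ _ s2) ?subrr//.
- by apply/adapted_measurable_fun; exact: measurable_funrneg.
- by apply/adapted_measurable_fun; exact: measurable_funrpos.
Qed.

End integration.

(** * Uniqueness from trigonometric integrals *)

Section sine.
Context {R : realType}.
Implicit Types x : R.

Lemma normr_sin_le x : `|sin x| <= `|x|.
Proof.
wlog x0 : x / 0 <= x => [H|].
  have [|x0] := leP 0 x; first exact: H.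
  by rewrite -normrN -[leRHS]normrN -sinN H// oppr_ge0 ltW.
have [c _] : exists2 c, c \in `[0, x] & sin x - sin 0 = cos c * (x - 0) :> R.
  apply: (@MVT_segment R sin cos 0 x) => //.
  by apply: continuous_subspaceT => z; exact: continuous_sin.
by rewrite sin0 !subr0 => ->; rewrite normrM ler_piMl// cos_max.
Qed.

(** The derivative of [sin] at 0 along [x / (n + 1)]. It recovers a linear variable from
    trigonometric functions of its multiples. *)
Lemma cvg_sin_scale x : (fun n => n.+1%:R * sin (n.+1%:R^-1 * x)) @ \oo --> x.
Proof.
have [->|x0] := eqVneq x 0.
  by under eq_fun do rewrite mulr0 sin0 mulr0; exact: cvg_cst.
have h0 : (fun n => n.+1%:R^-1 * x) @ \oo --> 0^'.
  have c0 : (fun n => n.+1%:R^-1 * x) @ \oo --> 0.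
    by rewrite -[X in _ --> X](mul0r x); apply: cvgM (cvg_cst _); exact: cvg_harmonic.
  move=> A /c0[N _ NA]; exists N => // n /NA; apply.
  by apply: mulf_neq0 => //; rewrite invr_eq0 pnatr_eq0.
have dsin : h^-1 *: (sin (h + 0) - sin 0) @[h --> 0^'] --> (1 : R).
  have [] := is_derive_sin (0 : R); rewrite cos0 => dsin <-.
  rewrite /derive; move: dsin; rewrite /derivable.
  by under eq_fun do rewrite /= [_ *: 1]mulr1.
have := cvgM (cvg_cst x) (cvg_comp _ _ h0 dsin).
rewrite mulr1 [X in X @ _ --> _](_ : _ =
  fun n : nat => n.+1%:R * sin (n.+1%:R^-1 * x)); first exact.
apply/funext => n /=.
rewrite addr0 sin0 subr0 /GRing.scale/= mulrA; congr (_ * _).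
by rewrite invfM invrK mulrCA divff// mulr1.
Qed.

(** An odd cubic mapping [[-1, 1]] to itself, with fixed points -1, 0, 1 and zero derivative at -1
    and 1: its iterates converge to the sign while remaining polynomials. *)
Definition smoothsign x := (3 * x - x ^+ 3) / 2.

Lemma smoothsign_bound x : `|x| <= 1 -> `|smoothsign x| <= 1.
Proof.
rewrite !ler_norml /smoothsign => /andP[x1 x2].
(* [smoothsign] is tangent to its bounds at 1 and -1, so [1 - smoothsign x] and [1 + smoothsign x]
   each have a double root. *)
have h1 : 0 <= (1 - x) ^+ 2 * (2 + x) by rewrite mulr_ge0 ?sqr_ge0//; lra.
have h2 : 0 <= (1 + x) ^+ 2 * (2 - x) by rewrite mulr_ge0 ?sqr_ge0//; lra.
rewrite (_ : _ * _ = 2 - (3 * x - x ^+ 3)) in h1; last by ring.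
rewrite (_ : _ * _ = 2 + (3 * x - x ^+ 3)) in h2; last by ring.
by apply/andP; split; lra.
Qed.

Lemma iter_smoothsign_bound n x : `|x| <= 1 -> `|iter n smoothsign x| <= 1.
Proof. by move=> x1; elim: n => //= n; exact: smoothsign_bound. Qed.

Lemma iter_smoothsignN n x : iter n smoothsign (- x) = - iter n smoothsign x.
Proof. by elim: n => //= n ->; rewrite /smoothsign; field. Qed.

(** With [y] an iterate, [1 - smoothsign y = (1 - y (1 + y) / 2) (1 - y)]. The iterates never fall
    below [x], so the factor is at most [1 - x / 2] and the convergence is geometric. *)
Lemma iter_smoothsign_gt0 n x : 0 < x <= 1 ->
  x <= iter n smoothsign x <= 1 /\
  1 - iter n smoothsign x <= (1 - x / 2) ^+ n.
Proof.
move=> /andP[x0 x1]; elim: n => [|n [/andP[]]] /=.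
  by rewrite expr0; split; [lra|lra].
set y := iter n _ x => xy y1 yn.
have y0 : 0 < y by exact: lt_le_trans xy.
have yS : smoothsign y = y + y * (1 - y) * (1 + y) / 2.
  by rewrite /smoothsign; field.
have xS : x <= smoothsign y <= 1.
  apply/andP; split.
    rewrite yS (le_trans xy)// lerDl divr_ge0// !mulr_ge0//; lra.
  have := @smoothsign_bound y; rewrite !ler_norml y1 andbT => /(_ _)/andP[]//.
  lra.
split=> //; rewrite exprS.
have : 1 - smoothsign y <= (1 - x / 2) * (1 - y).
  rewrite (_ : 1 - smoothsign y = (1 - y * (1 + y) / 2) * (1 - y)); last first.
    by rewrite /smoothsign; field.
  rewrite ler_wpM2r ?subr_ge0// lerD2l lerN2 ler_pM2r ?invr_gt0// (le_trans xy)//.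
  by apply: ler_peMr; rewrite ?lerDl; exact: ltW.
move/le_trans; apply; apply: ler_wpM2l => //; lra.
Qed.

Lemma cvg_iter_smoothsign x : `|x| <= 1 ->
  (fun n => iter n smoothsign x) @ \oo --> Num.sg x.
Proof.
have pos y : 0 < y <= 1 -> (fun n => iter n smoothsign y) @ \oo --> (1 : R).
  move=> y01; have g0 : (fun n => (1 - y / 2) ^+ n) @ \oo --> (0 : R).
    by apply: cvg_expr; rewrite ger0_norm; lra.
  have {g0} : (fun n => 1 - (1 - y / 2) ^+ n) @ \oo --> (1 : R).
    by rewrite -[X in _ --> X]subr0; apply: cvgB => //; exact: cvg_cst.
  move=> g1; apply: (@squeeze_cvgr _ _ _ _ _ (fun=> 1) _ _ _ g1); last exact: cvg_cst.
  apply: nearW => n; have [/andP[_ h1] h2] := iter_smoothsign_gt0 n y01.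
  by rewrite h1 andbT; lra.
rewrite ler_norml => /andP[x1 x2].
have [x0|x0|->] := ltgtP x 0.
- rewrite ltr0_sg// -[x]opprK.
  under eq_fun do rewrite iter_smoothsignN.
  by apply: cvgN; apply: pos; lra.
- by rewrite gtr0_sg//; apply: pos; lra.
- rewrite sgr0 (_ : (fun n => _) = fun=> 0); first exact: cvg_cst.
  by apply/funext; elim=> //= n ->; rewrite /smoothsign; field.
Qed.

End sine.

Section trigonometric_uniqueness.
Context {d : measure_display} {Omega : measurableType d} {R : realType}.
Variable P : {finite_measure set Omega -> \bar R}.
Variable W : set (Omega -> R).
Hypothesis W_meas : forall w, W w -> measurable_fun setT w.
Hypothesis WD : forall u v, W u -> W v -> W (fun t => u t + v t).
Hypothesis WZ : forall c u, W u -> W (fun t => c * u t).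
Hypothesis W_cst : forall c, W (fun=> c).

(** Cosines suffice: [W] contains the constants, so a sine is a cosine with phase [- pi / 2], and a
    constant is a multiple of [cos 0]. *)
Inductive trigpoly : (Omega -> R) -> Prop :=
| trig_cos c w : W w -> trigpoly (fun t => c * cos (w t))
| trigD f g : trigpoly f -> trigpoly g -> trigpoly (fun t => f t + g t).

Let eq_trig f g : f =1 g -> trigpoly f -> trigpoly g.
Proof. by move=> /funext ->. Qed.

Lemma trig_cst c : trigpoly (fun=> c).
Proof.
apply: eq_trig (trig_cos c (W_cst 0)) => t; by rewrite cos0 mulr1.
Qed.

Lemma trigZ c f : trigpoly f -> trigpoly (fun t => c * f t).
Proof.
elim=> [e w Ww|f1 g1 _ tf1 _ tg1].
  by apply: eq_trig (trig_cos (c * e) Ww) => t; rewrite mulrA.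
by apply: eq_trig (trigD tf1 tg1) => t; rewrite mulrDr.
Qed.

Lemma trigM f g : trigpoly f -> trigpoly g -> trigpoly (fun t => f t * g t).
Proof.
move=> + tg; elim=> [a u Wu|f1 g1 _ tf1 _ tg1]; last first.
  by apply: eq_trig (trigD tf1 tg1) => t; rewrite mulrDl.
elim: tg => [b v Wv|f1 g1 _ tf1 _ tg1]; last first.
  by apply: eq_trig (trigD tf1 tg1) => t; rewrite mulrDr.
apply: eq_trig (trigD (trig_cos (a * b / 2) (WD Wu Wv))
  (trig_cos (a * b / 2) (WD Wu (WZ (-1) Wv)))) => t.
by rewrite mulN1r cosB cosD; field.
Qed.

Lemma trig_meas f : trigpoly f -> measurable_fun setT f.
Proof.
elim=> [c w Ww|f1 g1 _ mf1 _ mg1]; last exact: measurable_funD.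
apply: measurable_funM => //; apply: measurableT_comp; last exact: W_meas.
by apply: continuous_measurable_fun; exact: continuous_cos.
Qed.

Lemma trig_bounded f : trigpoly f -> exists M, forall t, `|f t| <= M.
Proof.
elim=> [c w Ww|f1 g1 _ [M fM] _ [N gN]].
  by exists `|c| => t; rewrite normrM ler_piMr// cos_max.
by exists (M + N) => t; rewrite (le_trans (ler_normD _ _))// lerD.
Qed.

Lemma trig_smoothsign f n : trigpoly f ->
  trigpoly (fun t => iter n smoothsign (f t)).
Proof.
move=> tf; elim: n => //= n IH.
apply: eq_trig (trigD (trigZ (3 / 2) IH)
  (trigZ (- 2^-1) (trigM IH (trigM IH IH)))) => t.
by rewrite /smoothsign; field.
Qed.

(** The uniform bound 1 serves twice: it survives products, giving stability under intersection, and
    it permits dominated convergence against any integrable [g]. *)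
Definition trig_event : set (set Omega) := [set A | measurable A /\
  exists g : nat -> Omega -> R, [/\ forall n, trigpoly (g n),
    forall n t, `|g n t| <= 1 & forall t, g ^~ t @ \oo --> (\1_A t : R)]].

Lemma trig_eventI : setI_closed trig_event.
Proof.
move=> A B [mA [f [tf f1 fA]]] [mB [g [tg g1 gB]]]; split.
  exact: measurableI.
exists (fun n t => f n t * g n t); split=> [n|n t|t].
- exact: trigM.
- by rewrite normrM mulr_ile1.
- by rewrite indicI; apply: cvgM; [exact: fA|exact: gB].
Qed.

(* [(s ^+ 2 - s) / 2] is the indicator of [s = -1] for [s] in [{-1, 0, 1}]. *)
Lemma trig_event_lt0 f : trigpoly f -> trig_event [set t | f t < 0].
Proof.
move=> tf; have mf := trig_meas tf; split.
  by rewrite -[X in measurable X]setTI; apply: measurable_fun_ltr.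
have [M fM] := trig_bounded tf.
(* Rescaling brings [f] into [[-1, 1]], where the iteration converges; the added 1 keeps [K]
   positive even if [M] is 0. *)
pose K := `|M| + 1; have K0 : 0 < K by rewrite ltr_wpDl.
pose h t := K^-1 * f t.
have th : trigpoly h by exact: trigZ.
have h1 t : `|h t| <= 1.
  rewrite normrM normfV (gtr0_norm K0) ler_pdivrMl// mulr1.
  by rewrite (le_trans (fM t))// (le_trans (ler_norm M))// lerDl.
have hn1 n t := iter_smoothsign_bound n (h1 t).
exists (fun n t => 2^-1 * (iter n smoothsign (h t) * iter n smoothsign (h t)
  + (-1) * iter n smoothsign (h t))); split.
- move=> n; apply: trigZ; apply: trigD.
    by apply: trigM; exact: trig_smoothsign.
  by apply: trigZ; exact: trig_smoothsign.
- move=> n t; have := hn1 n t; rewrite !ler_norml => /andP[a b].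
  by apply/andP; split; nra.
- move=> t; have -> : \1_[set t | f t < 0] t =
      2^-1 * (Num.sg (h t) * Num.sg (h t) + (-1) * Num.sg (h t)) :> R.
    rewrite indicE sgrM [Num.sg K^-1]gtr0_sg ?invr_gt0// mul1r.
    have [f0|f0|f0] := ltgtP (f t) 0.
    + by rewrite mem_set// ltr0_sg//=; field.
    + rewrite memNset ?gtr0_sg//=; [by field|].
      by move=> /=; rewrite ltNge ltW.
    + rewrite memNset ?f0 ?sgr0//=; [by field|].
      by rewrite /= f0 ltxx.
  apply: cvgM; first exact: cvg_cst.
  apply: cvgD; last apply: cvgM; first apply: cvgM;
    by [exact: cvg_iter_smoothsign | exact: cvg_cst].
Qed.

(** [w] is the limit of [n sin (w / n)]. Each term is a trigonometric polynomial [f], and [f < c] is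
    the event [f - c < 0]; the rays below [c] generate the Borel sets. *)
Lemma trig_event_sigma w (B : set R) : W w -> measurable B ->
  <<s trig_event>> (w @^-1` B).
Proof.
move=> Ww; move: B; apply/adapted_measurable_fun.
apply: (@measurable_fun_cvg _ (g_sigma_algebraType trig_event) _ _
  (fun n t => n.+1%:R * sin (n.+1%:R^-1 * w t))); last first.
  by move=> t _; exact: cvg_sin_scale.
move=> n; set f := (fun _ => _).
have tf : trigpoly f.
  apply: eq_trig (trig_cos n.+1%:R (WD (WZ n.+1%:R^-1 Ww) (W_cst (- (pi / 2))))) => t.
  by rewrite cosBpihalf.
move=> mT; apply: (measurability _ (RGenInftyO.measurableE R)) => //.
move=> _ [_ [c ->] <-]; rewrite setTI; apply: sub_sigma_algebra.
have := trig_event_lt0 (trigD tf (trig_cst (- c))).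
congr trig_event; apply/seteqP; split=> t /=; rewrite in_itv/=; lra.
Qed.

(** By linearity [g] is orthogonal to trigonometric polynomials, by dominated convergence to the
    indicators of [trig_event], and by the Dynkin pi-lambda theorem to the sigma-algebra these
    generate. *)
Lemma trig_uniqueness (g : Omega -> R) (D : set (set Omega)) :
  summable P g -> (forall w, W w -> Ex P (fun t => g t * cos (w t)) = 0) ->
  (D `<=` \bigcup_(w in W) preimage_set_system setT w measurable) ->
  null_on P D g.
Proof.
move=> sg gW DW.
have tr0 f : trigpoly f ->
    summable P (fun t => g t * f t) /\ Ex P (fun t => g t * f t) = 0.
  move=> tf; split.
    by have [M fM] := trig_bounded tf; exact: summableMr (trig_meas tf) fM sg.
  elim: tf => [c w Ww|f1 f2 tf1 IH1 tf2 IH2].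
    rewrite -[RHS](mulr0 c) -(gW _ Ww) -ExZ.
      by apply: eq_Ex => t; rewrite mulrCA.
    apply: (@summableMr _ _ _ _ (fun t => cos (w t)) _ 1) => // [|t].
      by have := trig_meas (trig_cos 1 Ww); under eq_fun do rewrite mul1r.
    exact: cos_max.
  under eq_fun do rewrite mulrDr; rewrite ExD ?IH1 ?IH2 ?addr0//.
    by have [M fM] := trig_bounded tf1; exact: summableMr (trig_meas tf1) fM sg.
  by have [M fM] := trig_bounded tf2; exact: summableMr (trig_meas tf2) fM sg.
have ev0 A : trig_event A -> Ex P (fun t => g t * \1_A t) = 0.
  move=> [mA [f [tf f1 fA]]].
  apply: (@Ex_lim0 _ _ _ _ (fun n t => g t * f n t) _ (fun t => `|g t|)).
  - by move=> n; exact: (summable_meas (tr0 _ (tf n)).1).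
  - by apply: (@summable_meas _ _ _ P); exact: summableM_indic.
  - by move=> t; apply: cvgM; [exact: cvg_cst|exact: fA].
  - exact: integrable_norm.
  - by move=> n t; rewrite normrM ler_piMr.
  - by move=> n; exact: (tr0 _ (tf n)).2.
have mT : trig_event `<=` measurable by move=> A [].
have : null_on P trig_event g.
  have gT : Ex P (fun t => g t * \1_[set: Omega] t) = 0.
    rewrite -(tr0 _ (trig_cst 1)).2; apply: eq_Ex => t.
    by rewrite indicE in_setT.
  move=> A tA; suff : measurable A /\ Ex P (fun t => g t * \1_A t) = 0 by case.
  move: A tA; rewrite -setI_closed_g_dynkin_g_sigma_algebra; last exact: trig_eventI.
  apply: smallest_sub; last by move=> A tA; split; [exact: mT|exact: ev0].
  split.
  - by split.
  - move=> A [mA A0]; split; first exact: measurableC.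
    rewrite -[RHS](subrr 0) -[X in X - _]gT -A0 -ExB; try exact: summableM_indic.
    apply: eq_Ex => t; rewrite -mulrBr; congr (_ * _).
    have [At|nAt] := pselect (A t).
      by rewrite !indicE in_setT (mem_set At) subrr memNset//; exact.
    by rewrite !indicE in_setT (memNset nAt) subr0 mem_set.
  - move=> F tF F0.
    have mF n : measurable (F n) by case: (F0 n).
    split; first exact: bigcup_measurable.
    (* The partial unions converge pointwise to the union, with [|g|] as dominating function.
       Disjointness lets their indicators grow by one summand at a time. *)
    pose U n := \bigcup_(i in `I_n) F i.
    have mU n : measurable (U n) by apply: bigcup_measurable => i _.
    apply: (@Ex_lim0 _ _ _ _ (fun n t => g t * \1_(U n) t) _ (fun t => `|g t|)).
    + by move=> n; apply: (@summable_meas _ _ _ P); exact: summableM_indic.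
    + by apply: (@summable_meas _ _ _ P); apply: summableM_indic => //; exact: bigcup_measurable.
    + move=> t; apply: cvgM; first exact: cvg_cst.
      have [[k _ Fk]|nF] := pselect ((\bigcup_n F n) t).
        apply: cvg_near_cst; exists k.+1 => // n kn.
        by rewrite !indicE !mem_set//; exists k.
      rewrite indicE memNset// (_ : (fun n => _) = fun=> 0); first exact: cvg_cst.
      apply/funext => n; rewrite indicE memNset// => -[k _ Fk].
      by apply: nF; exists k.
    + exact: integrable_norm.
    + by move=> n t; rewrite normrM ler_piMr// normr_indic_le1.
    + elim=> [|n IH].
        rewrite -[RHS](Ex0 P); apply: eq_Ex => t.
        by rewrite indicE memNset ?mulr0// => -[].
      rewrite -[RHS](addr0 0) -{1}IH -(F0 n).2 -ExD; try exact: summableM_indic.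
      apply: eq_Ex => t; rewrite -mulrDr; congr (_ * _); rewrite !indicE.
      have [Ft|nFt] := pselect (F n t).
        have UtS : U n.+1 t by exists n => /=.
        have nUt : ~ U n t.
          move=> [k /= kn Fk]; have kE : k = n by apply: (tF k n) => //; exists t.
          by rewrite kE ltnn in kn.
        by rewrite (mem_set Ft) (mem_set UtS) (memNset nUt) add0r.
      rewrite (memNset nFt) addr0; congr (nat_of_bool _)%:R.
      apply/idP/idP; rewrite !inE => -[k /= kn Fk]; exists k => //=; last exact: ltnW.
      by move: kn; rewrite ltnS leq_eqVlt => /predU1P[kE|//]; rewrite kE in Fk.
move=> trig0 A DA; apply: trig0; move: A DA.
apply: smallest_sub; first exact: smallest_sigma_algebra.
by move=> A /DW[w Ww [B mB <-]]; rewrite setTI; exact: trig_event_sigma.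
Qed.

End trigonometric_uniqueness.

(** * The characteristic function of the normal law *)

Section normal_integrals.
Context {R : realType}.
Local Notation mu := (@lebesgue_measure R).
Variable s : R.
Hypothesis s_neq0 : s != 0.
Local Notation p := (normal_pdf 0 s).
Local Notation N := (normal_prob 0 s).

(** The Radon-Nikodym derivative of the normal law agrees almost everywhere with [p], since both
    have the same integral over every measurable set. *)
Lemma ge0_integral_normal_prob (f : R -> \bar R) :
  measurable_fun setT f -> (forall x, (0 <= f x)%E) ->
  (\int[N]_x f x = \int[mu]_x (f x * (p x)%:E))%E.
Proof.
move=> mf f0; have Nmu := normal_prob_dominates 0 s.
rewrite -(Radon_Nikodym_SigmaFinite.change_of_variables Nmu)//=.
have intg := Radon_Nikodym_SigmaFinite.f_integrable Nmu.
apply: ae_eq_integral => //.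
- by apply: emeasurable_funM => //; exact: measurable_int intg.
- apply: emeasurable_funM => //; apply/measurable_EFinP.
  exact: measurable_normal_pdf.
- apply: ae_eqe_mul2l; apply: integral_ae_eq => //.
  + by apply/measurable_EFinP; exact: measurable_normal_pdf.
  + by move=> E _ mE; rewrite -Radon_Nikodym_SigmaFinite.f_integral.
Qed.

Lemma summable_normal (f : R -> R) : measurable_fun setT f ->
  (summable N f <-> mu.-integrable setT (fun x => (f x * p x)%:E)).
Proof.
move=> mf; have E : (\int[N]_x `|(f x)%:E| = \int[mu]_x `|(f x * p x)%:E|)%E.
  rewrite ge0_integral_normal_prob//; last by do 2 apply: measurableT_comp => //.
  by apply: eq_integral => x _; rewrite /= normrM [`|p x|]ger0_norm ?normal_pdf_ge0.
split=> /integrableP[_ fi]; apply/integrableP; split.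
- by apply/measurable_EFinP/measurable_funM => //; exact: measurable_normal_pdf.
- by rewrite -E.
- exact/measurable_EFinP.
- by rewrite /= E.
Qed.

Lemma Ex_normal (f : R -> R) : summable N f ->
  Ex N f = \int[mu]_x (f x * p x).
Proof.
move=> sf; have mf := summable_meas sf.
have sp : summable N f^\+ by exact: integrable_funrpos.
have sn : summable N f^\- by exact: integrable_funrneg.
have fE x : f x = f^\+ x - f^\- x.
  rewrite /funrpos /funrneg; have [f0|f0] := leP 0 (f x).
    by rewrite max_r ?subr0// oppr_le0.
  by rewrite max_l ?sub0r ?opprK// oppr_ge0 ltW.
have ge0E (g : R -> R) : summable N g -> (forall x, 0 <= g x) ->
    Ex N g = \int[mu]_x (g x * p x).
  move=> sg g0; rewrite /Ex /Rintegral ge0_integral_normal_prob//.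
  by apply/measurable_EFinP; exact: summable_meas sg.
have isp : mu.-integrable setT (fun x => (f^\+ x * p x)%:E).
  by apply/(summable_normal (summable_meas sp)).
have isn : mu.-integrable setT (fun x => (f^\- x * p x)%:E).
  by apply/(summable_normal (summable_meas sn)).
rewrite (eq_Ex N fE) ExB// (ge0E _ sp (funrpos_ge0 f)) (ge0E _ sn (funrneg_ge0 f)).
rewrite -(RintegralB measurableT isp isn).
by apply: eq_Rintegral => x _; rewrite [in RHS]fE mulrBl.
Qed.

(** Put [u = x ^ 2 / (4 s ^ 2)]. The density decays like [exp (- 2 u)], and [u exp (- u) <= 1]
    trades the factor [x ^ 2] for half of the exponent; the other half is the density with deviation
    [sqrt 2 * s]. The bound yields both the second moment and the decay at infinity. *)
Lemma normal_pdf_sqr_le : exists2 K, 0 <= K &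
  forall x, x ^+ 2 * p x <= K * normal_pdf 0 (Num.sqrt 2 * s) x.
Proof.
have s2 : Num.sqrt 2 * s != 0 by rewrite mulf_neq0// gt_eqF// sqrtr_gt0.
have pk := normal_peak_gt0 s2.
exists (4 * s ^+ 2 * normal_peak s / normal_peak (Num.sqrt 2 * s)).
  by rewrite divr_ge0 ?normal_peak_ge0// mulr_ge0 ?normal_peak_ge0// mulr_ge0 ?sqr_ge0.
move=> x; rewrite !normal_pdfE//.
have key : x ^+ 2 * normal_fun 0 s x
    <= 4 * s ^+ 2 * normal_fun 0 (Num.sqrt 2 * s) x.
  rewrite /normal_fun !subr0; pose u := x ^+ 2 / (4 * s ^+ 2).
  have s20 : 0 < s ^+ 2 by rewrite exprn_even_gt0//=.
  have -> : - x ^+ 2 / (s ^+ 2 *+ 2) = - u + - u.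
    by rewrite /u -mulr_natr; field.
  have -> : - x ^+ 2 / ((Num.sqrt 2 * s) ^+ 2 *+ 2) = - u.
    by rewrite exprMn sqr_sqrtr// /u -mulr_natr; field.
  have -> : x ^+ 2 = u * (4 * s ^+ 2).
    by rewrite /u divfK// mulf_neq0// gt_eqF.
  have ue : u * expR (- u) <= 1.
    rewrite expRN ler_pdivrMr ?expR_gt0// mul1r.
    by rewrite (le_trans _ (expR_ge1Dx u))// lerDr.
  rewrite expRD mulrA ler_wpM2r ?expR_ge0// mulrAC ler_piMl//.
  by rewrite mulr_ge0// ltW.
rewrite mulrCA [leRHS](_ : _ = normal_peak s * (4 * s ^+ 2 *
  normal_fun 0 (Num.sqrt 2 * s) x)); first by rewrite ler_wpM2l ?normal_peak_ge0.
by field; rewrite gt_eqF.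
Qed.

Lemma summable_normal_sqr : summable N (fun x => x ^+ 2).
Proof.
have [K K0 pK] := normal_pdf_sqr_le.
have mx : measurable_fun [set: R] (fun x : R => x ^+ 2).
  by apply: continuous_measurable_fun; exact: exprn_continuous.
apply/(summable_normal mx).
have iK : mu.-integrable setT
    (fun x => K%:E * (normal_pdf 0 (Num.sqrt 2 * s) x)%:E)%E.
  by apply: integrableZl => //; exact: integrable_normal_pdf.
apply: le_integrable iK => //.
  apply/measurable_EFinP/measurable_funM; last exact: measurable_normal_pdf.
  exact: mx.
move=> x _; rewrite lee_fin (ger0_norm (mulr_ge0 (sqr_ge0 x) (normal_pdf_ge0 _ _ _))).
by rewrite ger0_norm ?mulr_ge0 ?normal_pdf_ge0.
Qed.

(** Removes the boundary terms in the integration by parts. For [n >= 1], [n p(n) <= n ^ 2 p(n)],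
    which is bounded. *)
Lemma cvg_normal_pdf0 : (fun n => p n%:R) @ \oo --> 0.
Proof.
have [K K0 pK] := normal_pdf_sqr_le.
set s' := Num.sqrt 2 * s in pK.
have s'0 : s' != 0 by rewrite mulf_neq0// gt_eqF// sqrtr_gt0.
pose M := K * normal_peak s'.
rewrite -cvg_shiftS; apply: (@squeeze_cvgr _ _ _ _ (fun=> 0) (fun n => M * n.+1%:R^-1)).
- apply: nearW => n; rewrite normal_pdf_ge0/= ler_pdivlMr//.
  have := pK n.+1%:R; have := normal_pdf_ub 0 n.+1%:R s'0.
  move=> /(ler_wpM2l K0) h1 /le_trans/(_ h1); apply: le_trans.
  rewrite mulrC ler_wpM2r ?normal_pdf_ge0// expr2 ler_peMr//.
  by rewrite ler1n.
- exact: cvg_cst.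
- rewrite -[X in _ --> X](mulr0 M); apply: cvgM; first exact: cvg_cst.
  exact: cvg_harmonic.
Qed.

Lemma is_derive_normal_pdf (x : R) :
  is_derive x 1 p (- (s ^- 2 * x * p x)).
Proof.
have -> : p = fun y => normal_peak s * expR (- (2 * s ^+ 2)^-1 * y ^+ 2).
  apply/funext => y; rewrite normal_pdfE//= /normal_fun subr0.
  by congr (_ * expR _); rewrite -mulr_natr; field.
by apply: is_derive_eq; rewrite /GRing.scale/=; field.
Qed.

Lemma is_derive_sin_scale (t x : R) :
  is_derive x 1 (fun y => sin (t * y)) (t * cos (t * x)).
Proof. by apply: is_derive_eq; rewrite /GRing.scale/=; ring. Qed.

Lemma is_derive_cos_scale (t x : R) :
  is_derive x 1 (fun y => cos (t * y)) (- (t * sin (t * x))).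
Proof. by apply: is_derive_eq; rewrite /GRing.scale/=; ring. Qed.

Let cos_scale_meas (t : R) : measurable_fun setT (fun x : R => cos (t * x)).
Proof.
apply: measurableT_comp; last exact: measurable_funM.
by apply: continuous_measurable_fun; exact: continuous_cos.
Qed.

Let sin_scale_meas (t : R) : measurable_fun setT (fun x : R => sin (t * x)).
Proof.
apply: measurableT_comp; last exact: measurable_funM.
by apply: continuous_measurable_fun; exact: continuous_sin.
Qed.

Let summable_cos t : summable N (fun x => cos (t * x)).
Proof.
by apply: (@summable_bounded _ _ _ _ _ 1) => [|x]; [exact: cos_scale_meas|exact: cos_max].
Qed.

Let summable_id : summable N id.
Proof. by apply: summable_sqr => //; exact: summable_normal_sqr. Qed.

Let summable_idsin t : summable N (fun x => sin (t * x) * x).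
Proof.
have h := @summableMl _ _ _ N (fun x => sin (t * x)) id 1 (sin_scale_meas t).
by apply: h => // x; exact: sin_max.
Qed.

(* Integration by parts, with antiderivative [s ^+ 2 * sin (t * x) * p x]. *)
Lemma normal_stein_sin t :
  Ex N (fun x => sin (t * x) * x) = s ^+ 2 * t * Ex N (fun x => cos (t * x)).
Proof.
apply/eqP; rewrite -subr_eq0; apply/eqP.
rewrite -ExZ// -ExB//; last exact: summableZ.
pose k x := sin (t * x) * x - s ^+ 2 * t * cos (t * x).
have sk : summable N k by apply: summableB => //; exact: summableZ.
rewrite (Ex_normal sk).
pose F x := - (s ^+ 2) * (sin (t * x) * p x).
have dF (x : R) : is_derive x 1 F (k x * p x).
  have h1 := is_derive_sin_scale t x; have h2 := is_derive_normal_pdf x.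
  have := is_deriveZ (- (s ^+ 2)) (is_deriveM h1 h2).
  congr (is_derive _ _ _ _); rewrite /k /GRing.scale/=.
  by field.
have cF : continuous F.
  by move=> x; apply/differentiable_continuous/derivable1_diffP; exact: ex_derive.
have ck : continuous (fun x => k x * p x).
  move=> x; apply/differentiable_continuous/derivable1_diffP.
  by have h := is_derive_normal_pdf x; apply: ex_derive.
have ik : mu.-integrable setT (fun x => (k x * p x)%:E).
  by apply/(summable_normal (summable_meas sk)).
(* The bounds use [n.+1] because the fundamental theorem of calculus needs a nondegenerate interval
   already at [n = 0]. *)
pose I n := `[- n.+1%:R : R, n.+1%:R]%classic.
have FTC n : (\int[mu]_(x in I n) (k x * p x)%:E =
    (F n.+1%:R - F (- n.+1%:R))%R%:E)%E.
  rewrite EFinB; apply: continuous_FTC2.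
  - by rewrite ltrNl (@lt_trans _ _ 0) ?oppr_lt0// ?ltr0n.
  - exact: continuous_subspaceT.
  - split; [by move=> x _; exact: ex_derive| |];
      [apply: cvg_at_right_filter|apply: cvg_at_left_filter]; exact: cF.
  - by move=> x _; rewrite derive1E; case: (dF x).
have [||||| _ _ cv] := @dominated_convergence _ _ R mu setT measurableT
  (fun n => (fun x => (k x * p x)%:E) \_ (I n)) (fun x => (k x * p x)%:E)
  (fun x => `|(k x * p x)%:E|)%E.
- move=> n; have mI : measurable (I n) by exact: measurable_itv.
  by apply/(measurable_restrictT _ mI)/measurable_funTS; exact: measurable_int ik.
- exact: measurable_int ik.
- apply: aeW => x _; apply: cvg_near_cst.
  exists (Num.truncn `|x|) => // n /= xn; rewrite patchE mem_set// /I /= in_itv/=.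
  by rewrite -ler_norml ltW// (lt_le_trans (truncnS_gt _))// ler_nat ltnS.
- exact: integrable_abse.
- by apply: aeW => x n _; rewrite patchE; case: ifPn => // _; rewrite abse0 abse_ge0.
have {}cv : (fun n => (F n.+1%:R - F (- n.+1%:R))%:E) @ \oo -->
    (\int[mu]_x (k x * p x)%:E)%E.
  move: cv; under eq_fun do rewrite -integral_mkcond FTC.
  exact.
(* [p] is even and the sine is odd, so the two boundary terms add up to a multiple of [p n.+1]. *)
have pN (x : R) : p (- x) = p x.
  by rewrite normal_pdfE// /normal_fun !subr0 sqrrN.
have F0 : (fun n : nat => F n.+1%:R - F (- n.+1%:R)) @ \oo --> (0 : R).
  apply: norm_cvg0.
  apply: (@squeeze_cvgr _ _ _ _ (fun=> 0) (fun n => 2 * s ^+ 2 * p n.+1%:R)).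
  - apply: nearW => n; rewrite normr_ge0/= /F mulrN sinN pN.
    set c := sin _; rewrite (_ : _ - _ = - (2 * s ^+ 2 * p n.+1%:R) * c); last by ring.
    have b0 : 0 <= 2 * s ^+ 2 * p n.+1%:R.
      by rewrite mulr_ge0 ?normal_pdf_ge0// mulr_ge0 ?sqr_ge0.
    by rewrite normrM normrN (ger0_norm b0) ler_piMr ?sin_max.
  - exact: cvg_cst.
  - rewrite -[X in _ --> X](mulr0 (2 * s ^+ 2)); apply: cvgM; first exact: cvg_cst.
    by have := cvg_normal_pdf0; rewrite -cvg_shiftS.
have {}F0 : (fun n : nat => (F n.+1%:R - F (- n.+1%:R))%:E) @ \oo --> (0%R : R)%:E.
  exact: (cvg_comp _ _ F0).
have -> : (\int[mu]_x (k x * p x)) = 0 by rewrite /Rintegral (cvg_unique _ cv F0).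
by [].
Qed.

Let chf t := Ex N (fun x => cos (t * x)).

(** Differentiation under the integral, dominated by [|x|], gives [- E[x sin (t x)]]; integration by
    parts turns this into a linear differential equation for [chf]. *)
Lemma is_derive_normal_chf (t : R) :
  is_derive t 1 chf (- (s ^+ 2 * t * chf t)).
Proof.
rewrite /chf -normal_stein_sin.
have pd (x y : R) : partial1of2 (fun t x => cos (t * x)) x y = - (sin (x * y) * y).
  rewrite partial1of2E; apply: derive_val.
  have := is_derive_cos_scale y x.
  by rewrite mulrC [y * x]mulrC; under [X in is_derive _ _ X]eq_fun do rewrite mulrC.
have tI : `]t - 1, t + 1[%classic t by rewrite /= in_itv/=; apply/andP; split; lra.
have iG : N.-integrable setT (EFin \o (fun x : R => `|x|)).
  exact: integrable_norm summable_id.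
have G_ub (x y : R) : `|partial1of2 (fun t x => cos (t * x)) x y| <= `|y|.
  by rewrite pd normrN normrM ler_piMl// sin_max.
have der (x y : R) : derivable (fun t : R => cos (t * y)) x 1.
  exact: ex_derive.
have d1 := @derivable_under_integral R _ _ N (fun t x : R => cos (t * x)) setT
  measurableT t (t - 1) (t + 1) tI (fun x _ => summable_cos x)
  (fun x y _ _ => der x y) (fun x : R => `|x|) (fun x : R => normr_ge0 x) iG
  (fun x y _ _ => G_ub x y).
have d2 := @differentiation_under_integral R _ _ N (fun t x : R => cos (t * x)) setT
  measurableT t (t - 1) (t + 1) tI (fun x _ => summable_cos x)
  (fun x y _ _ => der x y) (fun x : R => `|x|) (fun x : R => normr_ge0 x) iG
  (fun x y _ _ => G_ub x y).
apply: DeriveDef => //; rewrite -derive1E d2 -mulN1r -ExZ//.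
by apply: eq_Ex => x; rewrite pd mulN1r.
Qed.

(** [chf t * exp (s ^ 2 t ^ 2 / 2)] has zero derivative; its values at 0 and 1 are compared. *)
Lemma normal_chf_cos : Ex N cos = expR (- (s ^+ 2 / 2)).
Proof.
have dg (t : R) : is_derive t 1 (fun t : R => chf t * expR (s ^+ 2 / 2 * t ^+ 2)) 0.
  have h := is_derive_normal_chf t.
  by apply: is_derive_eq; rewrite /GRing.scale/=; field.
have := is_derive_0_is_cst 1 0 dg.
rewrite expr0n mulr0 expR0 expr1n !mulr1.
have -> : chf 0 = 1.
  rewrite /chf -[RHS](mul1r 1) -[X in _ = 1 * X](_ : fine (N setT) = 1).
    rewrite -Rintegral_cst//; apply: eq_Rintegral => x _.
    by rewrite mul0r cos0.
  by rewrite probability_setT.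
rewrite /chf; under eq_Ex do rewrite mul1r.
have e0 : expR (s ^+ 2 / 2) != 0 by rewrite gt_eqF// expR_gt0.
by move=> h; apply: (mulIf e0); rewrite expRN mulVf.
Qed.

End normal_integrals.

(** * Transfer of integrals to the law of a variable *)

Section laws.
Context {d : measure_display} {Omega : measurableType d} {R : realType}.
Variable P : probability Omega R.

Lemma summable_law (L : Omega -> R) (nu : probability (measurableTypeR R) R) (f : R -> R) :
  measurable_fun setT L ->
  (forall B : set R, measurable B -> P (L @^-1` B) = nu B) ->
  summable nu f -> summable P (f \o L) /\ Ex P (f \o L) = Ex nu f.
Proof.
move=> mL Lnu sf; have mf : measurable_fun setT f := summable_meas sf.
pose L' : {mfun Omega >-> measurableTypeR R} := MeasurableFun.Pack
  (MeasurableFun.Class (isMeasurableFun.Build _ _ Omega (measurableTypeR R) L mL)).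
have eqm A : measurable A -> A `<=` setT -> pushforward P L' A = nu A.
  by move=> mA _; exact: Lnu.
have s1 : summable P (f \o L).
  apply/integrableP; split; first exact/measurable_EFinP/measurableT_comp.
  have -> : (\int[P]_w `|((f \o L) w)%:E| = \int[nu]_x `|(f x)%:E|)%E.
    rewrite -(eq_measure_integral _ eqm) ge0_integral_pushforward//.
    by do 2 apply: measurableT_comp => //.
  by case/integrableP: sf.
split=> //; rewrite /Ex /Rintegral -(eq_measure_integral _ eqm).
by rewrite integral_pushforward//; exact/measurable_EFinP.
Qed.

Lemma Ex_indicator A : measurable A -> Ex P \1_A = fine (P A).
Proof. by move=> mA; rewrite /Ex /Rintegral integral_indic// setIT. Qed.

End laws.

(** * Independent families *)

Section independence.
Context {d : measure_display} {Omega : measurableType d} {R : realType}.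
Variable P : probability Omega R.
Variables (I : eqType) (J : set I) (G : I -> set (set Omega)).
Hypothesis G_meas : forall i, J i -> G i `<=` measurable.
Hypothesis G_indep : mutually_independent P J (fun i => <<s G i>>).

Definition bounded_adapted i (f : Omega -> R) :=
  adapted (G i) f /\ exists M, forall w, `|f w| <= M.

Lemma bounded_adapted_indic i A : <<s G i>> A -> bounded_adapted i \1_A.
Proof.
move=> GA; split; first exact: adapted_indic.
by exists 1 => w; exact: normr_indic_le1.
Qed.

Lemma bounded_adapted_summable i f : J i -> bounded_adapted i f -> summable P f.
Proof.
by move=> Ji [af [M fM]]; exact: summable_bounded (adapted_meas (G_meas Ji) af) fM.
Qed.

Lemma bounded_adapted_prod (f : I -> Omega -> R) (s : seq I) :
  (forall i, i \in s -> J i /\ bounded_adapted i (f i)) ->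
  measurable_fun setT (fun w => \prod_(i <- s) f i w) /\
  exists M, forall w, `|\prod_(i <- s) f i w| <= M.
Proof.
elim: s => [_|i s IH fs].
  under eq_fun do rewrite big_nil; split=> //.
  by exists 1 => w; rewrite big_nil normr1.
have [m [M IM]] : measurable_fun setT (fun w => \prod_(i <- s) f i w) /\
    exists M, forall w, `|\prod_(i <- s) f i w| <= M.
  by apply: IH => j js; apply: fs; rewrite inE js orbT.
have [Ji [af [K fK]]] := fs i (mem_head _ _).
split.
  under eq_fun do rewrite big_cons; apply: measurable_funM => //.
  exact: adapted_meas (G_meas Ji) af.
by exists (K * M) => w; rewrite big_cons normrM ler_pM.
Qed.

Lemma prod_indic (s : seq I) (E : I -> set Omega) w :
  \prod_(i <- s) (\1_(E i) w : R) = \1_(\bigcap_(i in [set` s]) E i) w.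
Proof.
have -> : \1_(\bigcap_(i in [set` s]) E i) w = (all (fun i => w \in E i) s)%:R :> R.
  rewrite indicE; congr (nat_of_bool _)%:R; apply/idP/allP => [/set_mem Ew i si|Ew].
    by apply/mem_set; exact: Ew.
  by apply/mem_set => i si; apply/set_mem/Ew.
elim: s => [|i s IH]; first by rewrite big_nil.
by rewrite big_cons IH /= indicE -natrM mulnb.
Qed.

(** Independence is the case where every factor is an indicator. The induction releases one factor
    at a time: those in [s] are still indicators, those in [t] are arbitrary bounded adapted
    functions. *)
Lemma Ex_prod_indep_aux (s t : seq I) (f : I -> Omega -> R) :
  uniq (s ++ t) -> (forall i, i \in s ++ t -> J i) ->
  (forall i, i \in s -> exists2 A, <<s G i>> A & f i = \1_A) ->
  (forall i, i \in t -> bounded_adapted i (f i)) ->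
  Ex P (fun w => \prod_(i <- s ++ t) f i w) = \prod_(i <- s ++ t) Ex P (f i).
Proof.
elim: t s f => [|i t IH] s f us sJ fs ft.
  rewrite cats0 in us sJ *.
  (* Recovers the event from its indicator, so that no choice among the existential witnesses is
     needed. *)
  pose E i := f i @^-1` [set 1].
  have fE i : i \in s -> <<s G i>> (E i) /\ f i = \1_(E i).
    move=> /fs[A GA fA]; suff <- : A = E i by [].
    apply/seteqP; split=> w; rewrite /E/= fA indicE.
      by move=> Aw; rewrite mem_set.
    by case: (boolP (w \in A)) => [/set_mem//|_ /eqP]; rewrite eq_sym oner_eq0.
  have mE i : i \in s -> measurable (E i).
    by move=> si; exact: sigma_meas (G_meas (sJ _ si)) (fE _ si).1.
  have := G_indep us sJ (fun i si => (fE i si).1).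
  have fP w : \prod_(i <- s) f i w = \1_(\bigcap_(i in [set` s]) E i) w.
    rewrite -prod_indic; apply: eq_big_seq => i si.
    by rewrite {1}(fE _ si).2.
  have mcap : measurable (\bigcap_(i in [set` s]) E i).
    have [i si|mf _] := @bounded_adapted_prod f s.
      split; first exact: sJ.
      by have [GE ->] := fE _ si; exact: bounded_adapted_indic.
    rewrite (_ : bigcap _ _ = (fun w => \prod_(i <- s) f i w) @^-1` [set 1]).
      by rewrite -[X in measurable X]setTI; exact: mf.
    apply/seteqP; split=> w /=; rewrite fP indicE.
      by move=> Ew; rewrite mem_set.
    by case: (boolP (w \in _)) => [/set_mem//|_ /eqP]; rewrite eq_sym oner_eq0.
  rewrite (eq_Ex P fP) Ex_indicator// => ->.
  have finE t : {subset t <= s} ->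
      (\prod_(i <- t) P (E i))%E = (\prod_(i <- t) fine (P (E i)))%:E.
    elim: t => [|i t IH] ts; first by rewrite !big_nil.
    rewrite !big_cons EFinM fineK ?IH//; first by move=> j jt; apply: ts; rewrite inE jt orbT.
    by apply: fin_num_measure; apply: mE; apply: ts; rewrite mem_head.
  rewrite finE//=; apply: eq_big_seq => i si.
  by rewrite [in RHS](fE _ si).2 Ex_indicator//; exact: mE.
have perm_it : perm_eq (s ++ i :: t) (i :: (s ++ t)) by rewrite -cat1s perm_catCA.
have uit : uniq (i :: (s ++ t)) by rewrite -(perm_uniq perm_it).
have /andP[ist ust] : (i \notin s ++ t) && uniq (s ++ t) by [].
have Jst j : j \in s ++ t -> J j.
  by move=> jst; apply: sJ; rewrite (perm_mem perm_it) inE jst orbT.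
have Ji : J i by apply: sJ; rewrite (perm_mem perm_it) mem_head.
have fst j : j \in s ++ t -> J j /\ bounded_adapted j (f j).
  move=> jst; split; first exact: Jst.
  move: jst; rewrite mem_cat => /orP[/fs[A GA ->]|jt].
    exact: bounded_adapted_indic.
  by apply: ft; rewrite inE jt orbT.
have fi : bounded_adapted i (f i) by apply: ft; rewrite mem_head.
pose H w := \prod_(j <- s ++ t) f j w.
have [mH [M HM]] := bounded_adapted_prod fst.
have sH : summable P H by exact: summable_bounded mH HM.
have EH : Ex P H = \prod_(j <- s ++ t) Ex P (f j).
  by apply: IH => // j jt; apply: ft; rewrite inE jt orbT.
(* The induction hypothesis with [f i] replaced by [\1_A] reads [E[1_A H] = P(A) E[H]]. So [H -
   E[H]] is orthogonal to the events of [G i], hence to the adapted function [f i]. *)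
have H0 : null_on P (G i) (fun w => H w - Ex P H).
  move=> A GA; have mA : measurable A by exact: sigma_meas (G_meas Ji) GA.
  pose f' j := if j == i then \1_A else f j.
  have f'E j : j \in s ++ t -> f' j = f j.
    by rewrite /f'; case: eqP => // ->; rewrite (negbTE ist).
  have f'i : f' i = \1_A by rewrite /f' eqxx.
  have f's j : j \in i :: s -> exists2 B, <<s G j>> B & f' j = \1_B.
    rewrite inE => /predU1P[->|js]; first by exists A.
    by rewrite f'E ?mem_cat ?js//; exact: fs.
  have f't j : j \in t -> bounded_adapted j (f' j).
    by move=> jt; rewrite f'E ?mem_cat ?jt ?orbT//; apply: ft; rewrite inE jt orbT.
  have f'J j : j \in (i :: s) ++ t -> J j.
    by rewrite -(perm_mem perm_it); exact: sJ.
  have IHA : Ex P (fun w => \1_A w * H w) = fine (P A) * Ex P H.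
    have := IH (i :: s) f' uit f'J f's f't; rewrite /= big_cons f'i Ex_indicator// EH.
    rewrite [in X in _ = X -> _](eq_big_seq (fun j => Ex P (f j))); last first.
      by move=> j /f'E ->.
    move=> <-; apply: eq_Ex => w; rewrite big_cons f'i; congr (_ * _).
    by apply: eq_big_seq => j /f'E ->.
  transitivity (Ex P (fun w => \1_A w * H w) - Ex P (fun w => Ex P H * \1_A w)).
    rewrite -ExB; first by apply: eq_Ex => w; ring.
      by under eq_fun do rewrite mulrC; exact: summableM_indic.
    by apply: summableZ; exact: integrable_indic.
  rewrite ExZ ?Ex_indicator//; last exact: integrable_indic.
  by rewrite IHA mulrC subrr.
have sfi : summable P (f i) := bounded_adapted_summable Ji fi.
have sHf : summable P (fun w => H w * f i w) by exact: summableMl mH HM sfi.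
have := null_on_adapted (G_meas Ji) (summableB sH (summable_cst P _)) H0 fi.1.
under eq_fun do rewrite mulrBl.
move=> /(_ (summableB sHf (summableZ _ sfi))).
rewrite ExB ?ExZ//; last exact: summableZ.
move=> /eqP; rewrite subr_eq0 => /eqP HfE.
rewrite (perm_big _ perm_it) big_cons/= -EH mulrC -HfE; apply: eq_Ex => w.
by rewrite (perm_big _ perm_it) big_cons/= mulrC.
Qed.

Lemma Ex_prod_indep (s : seq I) (f : I -> Omega -> R) :
  uniq s -> (forall i, i \in s -> J i) ->
  (forall i, i \in s -> bounded_adapted i (f i)) ->
  Ex P (fun w => \prod_(i <- s) f i w) = \prod_(i <- s) Ex P (f i).
Proof. by move=> us sJ fs; apply: (@Ex_prod_indep_aux [::] s). Qed.

Lemma measurable_sum_seq (t : seq I) (th : I -> Omega -> R) :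
  (forall i, i \in t -> measurable_fun setT (th i)) ->
  measurable_fun setT (fun w => \sum_(i <- t) th i w).
Proof.
elim: t => [_|i t IH mt]; first by under eq_fun do rewrite big_nil; exact: measurable_cst.
under eq_fun do rewrite big_cons; apply: measurable_funD.
  by apply: mt; rewrite mem_head.
by apply: IH => j jt; apply: mt; rewrite inE jt orbT.
Qed.

(** The addition formulas split one angle off the sum, and its cosine or sine joins the bounded
    factors indexed by [s]. They mix cosine and sine, so both identities are proved together; the
    terms with a lone [sin (th i)] vanish because its mean is 0. *)
Lemma Ex_trig_sum_indep_aux (t s : seq I) (th f : I -> Omega -> R) :
  uniq (s ++ t) -> (forall i, i \in s ++ t -> J i) ->
  (forall i, i \in s -> bounded_adapted i (f i)) ->
  (forall i, i \in t -> adapted (G i) (th i)) ->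
  (forall i, i \in t -> Ex P (fun w => sin (th i w)) = 0) ->
  Ex P (fun w => cos (\sum_(i <- t) th i w) * \prod_(i <- s) f i w) =
    \prod_(i <- t) Ex P (fun w => cos (th i w)) * \prod_(i <- s) Ex P (f i) /\
  Ex P (fun w => sin (\sum_(i <- t) th i w) * \prod_(i <- s) f i w) = 0.
Proof.
elim: t s f => [|i t IH] s f us sJ fs tht th0.
  rewrite cats0 in us sJ; rewrite big_nil mul1r -Ex_prod_indep//; split.
    by apply: eq_Ex => w; rewrite big_nil cos0 mul1r.
  by rewrite -[RHS](Ex0 P); apply: eq_Ex => w; rewrite big_nil sin0 mul0r.
have perm_it : perm_eq (s ++ i :: t) (i :: (s ++ t)) by rewrite -cat1s perm_catCA.
have uit : uniq ((i :: s) ++ t) by rewrite -(perm_uniq perm_it).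
have Jit j : j \in (i :: s) ++ t -> J j by rewrite -(perm_mem perm_it); exact: sJ.
have Ji : J i by apply: Jit; rewrite mem_head.
have thi : adapted (G i) (th i) by apply: tht; rewrite mem_head.
have tht' j : j \in t -> adapted (G j) (th j) by move=> jt; apply: tht; rewrite inE jt orbT.
have th0' j : j \in t -> Ex P (fun w => sin (th j w)) = 0.
  by move=> jt; apply: th0; rewrite inE jt orbT.
have mS : measurable_fun setT (fun w => \sum_(j <- t) th j w).
  apply: measurable_sum_seq => j jt; apply: adapted_meas (tht' _ jt).
  by apply: G_meas; apply: Jit; rewrite mem_cat jt orbT.
pose upd g j := if j == i then g else f j.
have updE g j : j \in s -> upd g j = f j.
  rewrite /upd; case: eqP => // -> si; move: us.
  by rewrite cat_uniq => /and3P[_ /hasPn/(_ i (mem_head _ _)) /negP + _]; exact.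
have updi g : upd g i = g by rewrite /upd eqxx.
have adapt_comp (h : R -> R) : continuous h -> (forall x, `|h x| <= 1) ->
    bounded_adapted i (fun w => h (th i w)).
  move=> ch h1; split; last by exists 1.
  move=> B mB; apply: (thi (h @^-1` B)).
  rewrite -[X in measurable X]setTI; apply: continuous_measurable_fun => //.
have IHg g : bounded_adapted i g ->
    Ex P (fun w => cos (\sum_(j <- t) th j w) * (g w * \prod_(j <- s) f j w)) =
    \prod_(j <- t) Ex P (fun w => cos (th j w)) * (Ex P g * \prod_(j <- s) Ex P (f j)) /\
    Ex P (fun w => sin (\sum_(j <- t) th j w) * (g w * \prod_(j <- s) f j w)) = 0.
  move=> bg; have updb j : j \in i :: s -> bounded_adapted j (upd g j).
    by rewrite inE => /predU1P[->|js]; [rewrite updi|rewrite updE//; exact: fs].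
  have := IH (i :: s) (upd g) uit Jit updb tht' th0'.
  rewrite !big_cons updi.
  have -> : \prod_(j <- s) Ex P (upd g j) = \prod_(j <- s) Ex P (f j).
    by apply: eq_big_seq => j js; rewrite updE.
  have E w : \prod_(j <- i :: s) upd g j w = g w * \prod_(j <- s) f j w.
    by rewrite big_cons updi; congr (_ * _); apply: eq_big_seq => j js; rewrite updE.
  by under [X in X = _ /\ _ -> _]eq_Ex do rewrite E;
    under [X in _ /\ X = _ -> _]eq_Ex do rewrite E.
have bc := adapt_comp _ (@continuous_cos R) (@cos_max R).
have bs := adapt_comp _ (@continuous_sin R) (@sin_max R).
have [c1 c2] := IHg _ bc; have [s1 s2] := IHg _ bs.
pose Pf w := \prod_(j <- s) f j w; pose S w := \sum_(j <- t) th j w.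
have [|mF [M FM]] := @bounded_adapted_prod f s.
  move=> j js; split; last exact: fs.
  by apply: Jit; rewrite inE mem_cat js orbT.
have sF : summable P Pf by exact: summable_bounded mF FM.
have sgF g : bounded_adapted i g -> summable P (fun w => g w * Pf w).
  move=> [ag [K gK]]; apply: summableMl gK sF.
  exact: adapted_meas (G_meas Ji) ag.
have mcS : measurable_fun setT (fun w => cos (S w)).
  by apply: measurableT_comp => //; apply: continuous_measurable_fun; exact: continuous_cos.
have msS : measurable_fun setT (fun w => sin (S w)).
  by apply: measurableT_comp => //; apply: continuous_measurable_fun; exact: continuous_sin.
have scS g : bounded_adapted i g -> summable P (fun w => cos (S w) * (g w * Pf w)).
  by move=> /sgF; apply: summableMl mcS _ => w; exact: cos_max.
have ssS g : bounded_adapted i g -> summable P (fun w => sin (S w) * (g w * Pf w)).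
  by move=> /sgF; apply: summableMl msS _ => w; exact: sin_max.
split.
  transitivity (Ex P (fun w => cos (S w) * (cos (th i w) * Pf w)) -
                Ex P (fun w => sin (S w) * (sin (th i w) * Pf w))).
    rewrite -ExB; [|exact: scS|exact: ssS].
    by apply: eq_Ex => w; rewrite big_cons cosD /Pf /S; ring.
  by rewrite c1 s2 subr0 big_cons; ring.
transitivity (Ex P (fun w => cos (S w) * (sin (th i w) * Pf w)) +
              Ex P (fun w => sin (S w) * (cos (th i w) * Pf w))).
  rewrite -ExD; [|exact: scS|exact: ssS].
  by apply: eq_Ex => w; rewrite big_cons sinD /Pf /S; ring.
by rewrite c2 s1 th0 ?mem_head// mul0r mulr0 addr0.
Qed.

Lemma Ex_trig_sum_indep (t : seq I) (th : I -> Omega -> R) :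
  uniq t -> (forall i, i \in t -> J i) ->
  (forall i, i \in t -> adapted (G i) (th i)) ->
  (forall i, i \in t -> Ex P (fun w => sin (th i w)) = 0) ->
  Ex P (fun w => cos (\sum_(i <- t) th i w)) =
    \prod_(i <- t) Ex P (fun w => cos (th i w)) /\
  Ex P (fun w => sin (\sum_(i <- t) th i w)) = 0.
Proof.
move=> ut tJ tht th0.
have fs i : i \in [::] -> bounded_adapted i (fun=> 0) by [].
have [h1 h2] := @Ex_trig_sum_indep_aux t [::] th (fun _ _ => 0) ut tJ fs tht th0.
rewrite [X in _ = _ * X]big_nil mulr1 in h1; split.
  by rewrite -h1; apply: eq_Ex => w; rewrite big_nil mulr1.
by rewrite -[RHS]h2; apply: eq_Ex => w; rewrite big_nil mulr1.
Qed.

End independence.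

(** * Projections for a positive semidefinite form *)

Section submodules.
Context {R : realType} (V : lmodType R).

Definition is_submod (K : set V) := K 0 /\ forall c u v, K u -> K v -> K (c *: u + v).

(** The intersection of all submodules containing [S]: membership is itself the induction principle,
    and no coefficients are carried around. *)
Definition spanned (S : set V) : set V := fun l => forall K, is_submod K -> S `<=` K -> K l.

Lemma spanned_submod S : is_submod (spanned S).
Proof.
split=> [K [K0 _] _ //|c u v Su Sv K sK SK].
by case: (sK) => _; apply; [exact: Su|exact: Sv].
Qed.

Lemma sub_spanned S : S `<=` spanned S.
Proof. by move=> u Su K _; apply. Qed.

Lemma spannedS S S' : S `<=` S' -> spanned S `<=` spanned S'.
Proof. by move=> SS' u Su K sK S'K; apply: Su => // v /SS'/S'K. Qed.

Lemma submodD K u v : is_submod K -> K u -> K v -> K (u + v).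
Proof. by case=> _ Kl Ku Kv; rewrite -[u]scale1r; exact: Kl. Qed.

Lemma submodZ K c u : is_submod K -> K u -> K (c *: u).
Proof. by case=> K0 Kl Ku; rewrite -[_ *: _]addr0; exact: Kl. Qed.

Lemma submodB K u v : is_submod K -> K u -> K v -> K (u - v).
Proof. by move=> sK Ku Kv; rewrite -scaleN1r; apply: submodD => //; exact: submodZ. Qed.

Lemma submod_sum K (I : Type) (s : seq I) (F : I -> V) : is_submod K ->
  (forall i, K (F i)) -> K (\sum_(i <- s) F i).
Proof.
move=> sK KF; elim: s => [|i s IH]; first by rewrite big_nil; case: sK.
by rewrite big_cons; exact: submodD.
Qed.

Variable B : V -> V -> R.
Hypothesis B_sym : forall u v, B u v = B v u.
Hypothesis B_lin : forall c u v z, B (c *: u + v) z = c * B u z + B v z.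
Hypothesis B_ge0 : forall u, 0 <= B u u.

Lemma formD u v z : B (u + v) z = B u z + B v z.
Proof. by rewrite -[u in LHS]scale1r B_lin mul1r. Qed.

Lemma form0 z : B 0 z = 0.
Proof. by have := formD 0 0 z; rewrite addr0 => /eqP; rewrite addrC -subr_eq subrr => /eqP. Qed.

Lemma formZ c u z : B (c *: u) z = c * B u z.
Proof. by rewrite -[_ *: _]addr0 B_lin form0 addr0. Qed.

Lemma formB u v z : B (u - v) z = B u z - B v z.
Proof. by rewrite -scaleN1r addrC B_lin mulN1r addrC. Qed.

Lemma orthogonal_submod z : is_submod [set u | B z u = 0].
Proof.
split=> [|c u v]; first by rewrite /= B_sym form0.
by rewrite /= !(B_sym z) B_lin => -> ->; rewrite mulr0 addr0.
Qed.

(* The discriminant of the nonnegative polynomial [t |-> B (u + t e) (u + t e)]. *)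
Lemma isotropic_form0 e u : B e e = 0 -> B u e = 0.
Proof.
move=> e0; have pos t : 0 <= B u u + 2 * t * B u e.
  have := B_ge0 (t *: e + u); rewrite B_lin (B_sym e) (B_sym u) !B_lin e0.
  by rewrite (B_sym e u) => h; apply: le_trans h _; lra.
apply/eqP; apply/negP => /negP ue0.
have := pos (- (B u u + 1) / (2 * B u e)).
rewrite (_ : 2 * _ * _ = - (B u u + 1)); last by field.
lra.
Qed.

(** Gram-Schmidt for a semidefinite form. The induction is on the list with [u] general, because the
    hypothesis is applied both to [u] and to the new generator [b]. *)
Lemma orthogonal_projection (S : seq V) (u : V) :
  exists2 l, spanned [set` S] l & forall b, b \in S -> B (u - l) b = 0.
Proof.
elim: S u => [|b S IH] u.
  by exists 0 => //; case: (spanned_submod [set` [::]]).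
have [pb Spb pbS] := IH b; have [l Sl lS] := IH u.
have Ssub : spanned [set` S] `<=` spanned [set` b :: S].
  by apply: spannedS => v /= vS; rewrite inE vS orbT.
have sp := spanned_submod [set` b :: S].
pose e := b - pb.
have Se : spanned [set` b :: S] e.
  apply: (submodB sp); last exact: Ssub.
  by apply: sub_spanned; rewrite /= mem_head.
have orth z v : (forall b, b \in S -> B z b = 0) -> spanned [set` S] v -> B z v = 0.
  by move=> zS Sv; exact: (Sv _ (orthogonal_submod z)).
have bE : b = e + pb by rewrite /e subrK.
(* [e] is the part of [b] orthogonal to [S]. If it is isotropic, it is orthogonal to everything and
   the projection on [S] needs no correction; otherwise the usual quotient is defined. *)
have [e0|e0] := eqVneq (B e e) 0.
  exists l; first exact: Ssub.
  move=> c; rewrite inE => /predU1P[->|]; last exact: lS.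
  by rewrite B_sym bE formD (B_sym e) (B_sym pb) isotropic_form0// orth ?addr0.
exists ((B (u - l) e / B e e) *: e + l).
  by case: sp => _ sl; apply: sl => //; exact: Ssub.
have eS c : c \in S -> B e c = 0 by exact: pbS.
set t := _ / _; have -> : u - (t *: e + l) = (- t) *: e + (u - l).
  by rewrite opprD addrCA scaleNr.
have zS c : c \in S -> B (- t *: e + (u - l)) c = 0.
  by move=> cS; rewrite B_lin eS// lS// mulr0 addr0.
move=> c; rewrite inE => /predU1P[->|]; last exact: zS.
rewrite bE B_sym formD (B_sym e) (B_sym pb) (orth _ pb)// B_lin /t addr0.
by field.
Qed.

End submodules.

(** * Orthogonality in linear families with Gaussian characteristic function *)

Section gaussian_families.
Context {d : measure_display} {Omega : measurableType d} {R : realType}.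
Variable P : probability Omega R.
Variables (V : lmodType R) (ev : V -> Omega -> R) (B : V -> V -> R).
Hypothesis B_sym : forall u v, B u v = B v u.
Hypothesis B_lin : forall c u v z, B (c *: u + v) z = c * B u z + B v z.
Hypothesis ev_lin : forall c u v w, ev (c *: u + v) w = c * ev u w + ev v w.
Hypothesis ev_meas : forall v, measurable_fun setT (ev v).
Hypothesis ev_sqr : forall v, summable P (fun w => ev v w ^+ 2).
Hypothesis ev_cos : forall v, Ex P (fun w => cos (ev v w)) = expR (- (B v v / 2)).
Hypothesis ev_sin : forall v, Ex P (fun w => sin (ev v w)) = 0.

Lemma evD u v w : ev (u + v) w = ev u w + ev v w.
Proof. by rewrite -[u in LHS]scale1r ev_lin mul1r. Qed.

Lemma ev0 w : ev 0 w = 0.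
Proof. by have := evD 0 0 w; rewrite addr0 => /eqP; rewrite addrC -subr_eq subrr => /eqP. Qed.

Lemma evZ c u w : ev (c *: u) w = c * ev u w.
Proof. by rewrite -[_ *: _]addr0 ev_lin ev0 addr0. Qed.

Lemma evB u v w : ev (u - v) w = ev u w - ev v w.
Proof. by rewrite -scaleN1r addrC ev_lin mulN1r addrC. Qed.

Lemma ev_summable v : summable P (ev v).
Proof. exact: summable_sqr. Qed.

Let cos_meas v : measurable_fun setT (fun w => cos (ev v w)).
Proof. by apply: measurableT_comp => //; apply: continuous_measurable_fun; exact: continuous_cos. Qed.

Let sin_meas v : measurable_fun setT (fun w => sin (ev v w)).
Proof. by apply: measurableT_comp => //; apply: continuous_measurable_fun; exact: continuous_sin. Qed.

Let cos_summable v : summable P (fun w => cos (ev v w)).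
Proof. by apply: (@summable_bounded _ _ _ _ _ 1) => // w; exact: cos_max. Qed.

Let sin_summable v : summable P (fun w => sin (ev v w)).
Proof. by apply: (@summable_bounded _ _ _ _ _ 1) => // w; exact: sin_max. Qed.

(** The phase [c] is there because the uniqueness lemma needs constants in its family. Expanding
    [cos (b + c)] leaves [sin (t z) cos b], a mean of two sines of integral 0, and
    [sin (t z) sin b], where the equality of the two characteristic functions is used. The limit is
    dominated by [|z|], as [n |sin (z / n)| <= |z|]. *)
Lemma orthogonal_Ex_cos z b c : B z b = 0 ->
  Ex P (fun w => ev z w * cos (ev b w + c)) = 0.
Proof.
move=> zb.
have sc t : Ex P (fun w => sin (t * ev z w) * cos (ev b w)) = 0.
  transitivity (Ex P (fun w => 2^-1 * (sin (ev (t *: z + b) w) + sin (ev (t *: z - b) w)))).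
    by apply: eq_Ex => w; rewrite evB evD evZ sinB sinD; field.
  by rewrite ExZ ?ExD ?ev_sin ?addr0 ?mulr0//; exact: summableD.
have ss t : Ex P (fun w => sin (t * ev z w) * sin (ev b w)) = 0.
  transitivity (Ex P (fun w => 2^-1 * (cos (ev (t *: z - b) w) - cos (ev (t *: z + b) w)))).
    by apply: eq_Ex => w; rewrite evB evD evZ cosB cosD; field.
  rewrite ExZ ?ExB ?ev_cos//; last exact: summableB.
  have BB e : B (t *: z + e *: b) (t *: z + e *: b) = t * t * B z z + e * e * B b b.
    rewrite B_lin (formZ B_lin) (B_sym z) (B_sym b (_ + _)) !B_lin !(formZ B_lin).
    by rewrite (B_sym b z) zb; ring.
  have := BB 1; have := BB (-1); rewrite scale1r scaleN1r => -> ->.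
  by rewrite mulrNN subrr mulr0.
apply: (@Ex_lim0 _ _ _ _ (fun n w =>
  (n.+1%:R * sin (n.+1%:R^-1 * ev z w)) * cos (ev b w + c)) _ (fun w => `|ev z w|)).
- move=> n; apply: measurable_funM.
    apply: measurable_funM => //; apply: measurableT_comp.
      by apply: continuous_measurable_fun; exact: continuous_sin.
    exact: measurable_funM.
  apply: measurableT_comp; last exact: measurable_funD.
  by apply: continuous_measurable_fun; exact: continuous_cos.
- apply: measurable_funM => //; apply: measurableT_comp; last exact: measurable_funD.
  by apply: continuous_measurable_fun; exact: continuous_cos.
- by move=> w; apply: cvgM; [exact: cvg_sin_scale|exact: cvg_cst].
- exact: integrable_norm (ev_summable z).
- move=> n w; rewrite !normrM -[leRHS]mulr1 ler_pM ?cos_max ?mulr_ge0//.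
  rewrite ger0_norm// (le_trans (ler_wpM2l _ (normr_sin_le _)))//.
  by rewrite normrM ger0_norm// mulrA mulfV ?mul1r// pnatr_eq0.
move=> n; set t := n.+1%:R^-1.
have s1 : summable P (fun w => sin (t * ev z w) * cos (ev b w)).
  have := @summableMl _ _ _ P _ _ 1 (sin_meas (t *: z)) (fun w => sin_max _) (cos_summable b).
  by under eq_fun do rewrite evZ.
have s2 : summable P (fun w => sin (t * ev z w) * sin (ev b w)).
  have := @summableMl _ _ _ P _ _ 1 (sin_meas (t *: z)) (fun w => sin_max _) (sin_summable b).
  by under eq_fun do rewrite evZ.
transitivity (Ex P (fun w => (n.+1%:R * cos c) * (sin (t * ev z w) * cos (ev b w)) -
   (n.+1%:R * sin c) * (sin (t * ev z w) * sin (ev b w)))).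
  by apply: eq_Ex => w; rewrite cosD; ring.
by rewrite ExB ?ExZ ?sc ?ss ?mulr0 ?subr0//; exact: summableZ.
Qed.

Lemma orthogonal_null_on z (D : set (set Omega)) :
  (D `<=` \bigcup_(b in [set b | B z b = 0])
            preimage_set_system setT (ev b) measurable) ->
  null_on P D (ev z).
Proof.
move=> DS.
(* Adding constants to the orthogonal complement of [z] gives a family closed as [trig_uniqueness]
   requires. *)
pose W : set (Omega -> R) :=
  [set f | exists b c, B z b = 0 /\ f = (fun w => ev b w + c)].
apply: (@trig_uniqueness _ _ _ _ W).
- move=> f [b [c [_ ->]]]; exact: measurable_funD.
- move=> _ _ [b [c [zb ->]]] [b' [c' [zb' ->]]]; exists (b + b'), (c + c'); split.
    by rewrite B_sym (formD B_lin) !(B_sym _ z) zb zb' addr0.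
  by apply/funext => w; rewrite evD; ring.
- move=> e _ [b [c [zb ->]]]; exists (e *: b), (e * c); split.
    by rewrite B_sym (formZ B_lin) (B_sym _ z) zb mulr0.
  by apply/funext => w; rewrite evZ mulrDr.
- move=> c; exists 0, c; split; first by rewrite B_sym (form0 B_lin).
  by apply/funext => w; rewrite ev0 add0r.
- exact: ev_summable.
- by move=> _ [b [c [zb ->]]]; exact: orthogonal_Ex_cos.
- move=> A /DS[b /= zb bA]; exists (ev b) => //.
  by exists b, 0; split=> //; apply/funext => w; rewrite addr0.
Qed.

End gaussian_families.

(** * Conditional expectations *)

Section almost_everywhere.
Context {d : measure_display} {Omega : measurableType d} {R : realType}.
Variable P : {finite_measure set Omega -> \bar R}.
Implicit Types (f g : Omega -> R) (D : set (set Omega)).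

Lemma eq_ae_Ex f g : measurable_fun setT f -> measurable_fun setT g ->
  {ae P, forall w, f w = g w} -> Ex P f = Ex P g.
Proof.
move=> mf mg fg; congr fine; apply: ae_eq_integral => //;
  try exact/measurable_EFinP.
by apply: filterS fg => w /= -> _.
Qed.

Lemma Ex_norm0_ae g : summable P g -> Ex P (fun w => `|g w|) = 0 ->
  {ae P, forall w, g w = 0}.
Proof.
move=> sg g0; have mg : measurable_fun setT (EFin \o g).
  exact/measurable_EFinP/(summable_meas sg).
have [+ _] := ae_eq_integral_abs P measurableT mg.
have -> : (\int[P]_w `|(EFin \o g) w| = 0)%E.
  have s : summable P (fun w => `|g w|) by exact: integrable_norm.
  rewrite -[LHS]fineK; first by rewrite [fine _]g0.
  exact: integrable_fin_num s.
by move=> /(_ erefl); apply: filterS => w /= /(_ I) [].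
Qed.

(** Testing [g] against its own sign, which is adapted and bounded, gives [E|g| = 0]. *)
Lemma null_on_adapted_ae0 D g : D `<=` measurable -> summable P g ->
  adapted D g -> null_on P D g -> {ae P, forall w, g w = 0}.
Proof.
move=> mD sg ag g0; apply: Ex_norm0_ae => //.
have asg : adapted D (fun w => Num.sg (g w)).
  rewrite (_ : (fun w => _) =
    fun w => \1_[set w | 0 < g w] w - \1_[set w | g w < 0] w).
    by apply: adaptedB; apply: adapted_indic; [exact: adapted_gt|exact: adapted_lt].
  apply/funext => w; rewrite !indicE; have [g0'|g0'|g0'] := ltgtP (g w) 0.
  - by rewrite memNset ?mem_set ?ltr0_sg ?sub0r//=; rewrite ltNge ltW.
  - by rewrite mem_set ?memNset ?gtr0_sg ?subr0//=; rewrite ltNge ltW.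
  - by rewrite !memNset ?g0' ?sgr0 ?subrr//= g0' ltxx.
rewrite -[RHS](null_on_adapted mD sg g0 asg).
  by apply: eq_Ex => w; rewrite normrEsg mulrC.
have h1 w : `|Num.sg (g w)| <= 1 by rewrite normr_sg; case: (_ != _).
exact: summableMr (adapted_meas mD asg) h1 sg.
Qed.

Lemma integral_Ex f A : summable P f -> measurable A ->
  (\int[P]_(w in A) (f w)%:E = (Ex P (fun w => f w * \1_A w))%:E)%E.
Proof.
move=> sf mA; rewrite -Ex_indic// fineK//; apply: integrable_fin_num => //.
exact: integrableS sf.
Qed.

End almost_everywhere.

Section conditional_expectation.
Context {d : measure_display} {Omega : measurableType d} {R : realType}.
Variable P : probability Omega R.
Variable D : set (set Omega).
Hypothesis D_meas : D `<=` measurable.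
Implicit Types (f g X Z : Omega -> R).

Lemma is_cond_expP X Z : summable P X ->
  is_cond_exp P <<s D>> X Z <->
  [/\ adapted D Z, summable P Z & null_on P D (fun w => X w - Z w)].
Proof.
move=> sX; split=> [[aZ [sZ ZX]]|[aZ sZ ZX]].
  split=> // A DA; have mA := sigma_meas D_meas DA.
  have := ZX A DA; rewrite !integral_Ex// => -[ZXA].
  under eq_Ex do rewrite mulrBl; rewrite ExB ?ZXA ?subrr//; exact: summableM_indic.
split=> //; split=> // A DA; have mA := sigma_meas D_meas DA.
rewrite !integral_Ex//; congr EFin; apply/eqP; rewrite eq_sym -subr_eq0 -ExB;
  try exact: summableM_indic.
by rewrite -(ZX A DA); apply/eqP/eq_Ex => w; rewrite mulrBl.
Qed.

(** The charge [A |-> E[X 1_A]], retyped on the coarser sigma-algebra generated by [D]. Its charge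
    structure has to be supplied again, since measurability now refers to that sigma-algebra. *)
Definition trace_charge X (sX : summable P X) : set (g_sigma_algebraType D) -> \bar R :=
  induced_charge sX.

Section trace_charge.
Variables (X : Omega -> R) (sX : summable P X).

Let trace_charge0 : trace_charge sX set0 = 0%E.
Proof. exact: charge0. Qed.

Let trace_charge_fin A : measurable A -> trace_charge sX A \is a fin_num.
Proof. by move=> mA; apply: fin_num_measure; exact: sigma_meas mA. Qed.

Let trace_charge_additive : semi_sigma_additive (trace_charge sX).
Proof.
move=> F mF tF mUF; apply: charge_semi_sigma_additive => //.
  by move=> n; exact: sigma_meas (mF n).
exact: sigma_meas mUF.
Qed.

HB.instance Definition _ := isCharge.Build _ _ _ (trace_charge sX)
  trace_charge0 trace_charge_fin trace_charge_additive.
End trace_charge.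

Let id_meas : measurable_fun setT (id : Omega -> g_sigma_algebraType D).
Proof. by move=> _ B mB; rewrite setTI; exact: sigma_meas mB. Qed.

Let trace : {mfun Omega >-> g_sigma_algebraType D} := MeasurableFun.Pack
  (MeasurableFun.Class (isMeasurableFun.Build _ _ Omega (g_sigma_algebraType D) id id_meas)).

(** The identity, viewed as a map to the coarser space, has the restriction of [P] as its
    distribution. The Radon-Nikodym derivative taken on that space is measurable for [D] by
    construction. *)
Lemma cond_exp_exists X : summable P X -> exists Z, is_cond_exp P <<s D>> X Z.
Proof.
move=> sX; pose mu := distribution P trace.
pose nu : {charge set (g_sigma_algebraType D) -> \bar R} := trace_charge sX.
have numu : nu `<< mu.
  apply/null_content_dominatesP => A mA muA; have mA' := sigma_meas D_meas mA.
  apply: null_set_integral => //.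
  exact/measurable_EFinP/measurable_funTS/(summable_meas sX).
have fin := Radon_Nikodym_fin_num _ numu.
have int := Radon_Nikodym_integrable numu.
have intA A := @Radon_Nikodym_integral _ _ _ nu mu A numu.
set Z0 := Radon_Nikodym nu mu in fin int intA.
have mZ0 : measurable_fun setT Z0 := measurable_int _ int.
have mZ0' : measurable_fun (setT : set Omega) (Z0 : Omega -> \bar R).
  exact: measurableT_comp mZ0 id_meas.
have iZ0 : P.-integrable setT (Z0 : Omega -> \bar R).
  apply/integrableP; split=> //.
  case/integrableP : int => _; rewrite /mu ge0_integral_pushforward//.
  exact: measurableT_comp.
exists (fine \o Z0).
have Z0E : EFin \o (fine \o Z0) = Z0 by apply/funext => w /=; rewrite fineK.
have sZ : summable P (fine \o Z0) by rewrite /summable Z0E.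
apply/is_cond_expP => //; split=> //.
  by apply/adapted_measurable_fun; exact: measurableT_comp.
move=> A DA; have mA := sigma_meas D_meas DA.
have : (\int[P]_(w in A) (X w)%:E = \int[P]_(w in A) ((fine \o Z0) w)%:E)%E.
  have -> : (\int[P]_(w in A) ((fine \o Z0) w)%:E = \int[P]_(w in A) Z0 w)%E.
    by apply: eq_integral => w _; rewrite /= fineK.
  have iA : P.-integrable A (Z0 : Omega -> \bar R).
    by apply: integrableS iZ0.
  rewrite -[LHS]/(nu A) (intA A DA).
  exact: (integral_pushforward id_meas mZ0 iA DA).
rewrite !integral_Ex// => -[XZ]; under eq_Ex do rewrite mulrBl.
rewrite ExB ?XZ ?subrr//; exact: summableM_indic.
Qed.

(** The bounds hold everywhere, not just almost surely, so that multiplying by [Z] preserves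
    integrability. [Z'] clamps an arbitrary version to [[0, 1]]. *)
Lemma cond_prob_exists A : measurable A -> exists Z,
  is_cond_exp P <<s D>> \1_A Z /\ forall w, 0 <= Z w <= 1.
Proof.
move=> mA; have sA : summable P \1_A by exact: integrable_indic.
have [Z /(is_cond_expP Z sA)[aZ sZ ZA]] := cond_exp_exists sA.
have mZ := summable_meas sZ.
pose Z' w := Num.max 0 (Num.min (Z w) 1).
exists Z'; split; last first.
  by move=> w; rewrite /Z' le_max lexx/= ge_max ler01 ge_min lexx orbT.
have aZ' : adapted D Z'.
  apply/adapted_measurable_fun; apply: measurable_maxr => //.
  by apply: measurable_minr => //; exact/adapted_measurable_fun.
have Z'1 w : `|Z' w| <= 1.
  by rewrite ger0_norm /Z' ?le_max ?lexx// ge_max ler01 ge_min lexx orbT.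
have mZ' := adapted_meas D_meas aZ'.
have sZ' : summable P Z' by exact: summable_bounded mZ' Z'1.
(* [(1_A - Z) f] is nonnegative, and positive exactly where [Z] leaves [[0, 1]]. Its integral is 0
   because [f] is adapted, so clamping changes [Z] on a null set only. *)
pose f w : R := \1_[set w | Z w < 0] w - \1_[set w | 1 < Z w] w.
have af : adapted D f.
  by apply: adaptedB; apply: adapted_indic; [exact: adapted_lt|exact: adapted_gt].
have fE w : [\/ Z w < 0 /\ f w = 1, 1 < Z w /\ f w = -1 | 0 <= Z w <= 1 /\ f w = 0].
  rewrite /f !indicE; have [Z0|Z0] := ltP (Z w) 0.
    apply: Or31; split=> //; rewrite mem_set// memNset ?subr0//=.
    by apply/negP; rewrite -leNgt (le_trans (ltW Z0)).
  have [Z1|Z1] := ltP 1 (Z w).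
    apply: Or32; split=> //; rewrite memNset ?mem_set ?sub0r//=.
    by apply/negP; rewrite -leNgt.
  apply: Or33; split; first by apply/andP.
  by rewrite !memNset ?subrr//=; apply/negP; rewrite -leNgt.
have f1 w : `|f w| <= 1.
  by case: (fE w) => [[_ ->]|[_ ->]|[_ ->]]; rewrite ?normrN ?normr1 ?normr0.
have A01 w : 0 <= (\1_A w : R) <= 1 by rewrite indicE; case: (_ \in _); rewrite ?lexx ?ler01.
have sf : summable P (fun w => (\1_A w - Z w) * f w).
  exact: summableMr (adapted_meas D_meas af) f1 (summableB sA sZ).
have Ef := null_on_adapted D_meas (summableB sA sZ) ZA af sf.
have ZZ' : {ae P, forall w, Z w = Z' w}.
  have /Ex_norm0_ae : Ex P (fun w => `|(\1_A w - Z w) * f w|) = 0.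
    rewrite -[RHS]Ef; apply: eq_Ex => w; rewrite ger0_norm//.
    by have := A01 w; case: (fE w) => [[? ->]|[? ->]|[? ->]]; lra.
  move=> /(_ sf); apply: filterS => w.
  rewrite /Z'; have := A01 w; case: (fE w) => [[Z0 ->]|[Z0 ->]|[/andP[Z0 Z1] _]].
  - by lra.
  - by lra.
  - by rewrite min_l// max_r.
apply/is_cond_expP => //; split=> // B DB; rewrite -[RHS](ZA B DB).
have mB := sigma_meas D_meas DB.
apply: eq_ae_Ex; try by apply: measurable_funM => //; exact: measurable_funB.
by apply: filterS ZZ' => w ->.
Qed.

End conditional_expectation.

(** * From conditional independence of events to integrable variables *)

Section conditional_independence.
Context {d : measure_display} {Omega : measurableType d} {R : realType}.
Variable P : probability Omega R.
Variables D1 D2 D : set (set Omega).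
Hypothesis D1_meas : D1 `<=` measurable.
Hypothesis D2_meas : D2 `<=` measurable.
Hypothesis D_meas : D `<=` measurable.

(** The event-level hypothesis is first extended on the side of [D2], with [A] fixed. Events of [D1]
    are enough in the conclusion because [J_k] will be the adapted multiplier. *)
Lemma cond_indep_null_on (y l : Omega -> R) :
  cond_indep P <<s D1>> <<s D2>> <<s D>> ->
  summable P y -> adapted D2 y -> is_cond_exp P <<s D>> y l ->
  null_on P D1 (fun w => y w - l w).
Proof.
move=> CI sy ay /(is_cond_expP D_meas l sy)[al sl yl] A D1A.
have mA := sigma_meas D1_meas D1A.
have sA : summable P \1_A by exact: integrable_indic.
have [ZA [ceA ZA01]] := cond_prob_exists P D_meas mA.
have [aZA sZA ZAA] := (is_cond_expP D_meas ZA sA).1 ceA.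
have mZA := summable_meas sZA.
have ZA1 w : `|ZA w| <= 1 by have /andP[? ?] := ZA01 w; rewrite ger0_norm.
(* For [B] in [<<s D2>>]: [P(A & B) = E[ZAB] = E[ZA ZB] = E[ZA 1_B]]. The middle equality is the
   hypothesis, the last one holds because [ZA] is adapted to [D]. *)
have A_ZA : null_on P D2 (fun w => \1_A w - ZA w).
  move=> B D2B; have mB := sigma_meas D2_meas D2B.
  have mAB := measurableI _ _ mA mB.
  have sB : summable P \1_B by exact: integrable_indic.
  have sAB : summable P \1_(A `&` B) by exact: integrable_indic.
  have [ZB [ceB ZB01]] := cond_prob_exists P D_meas mB.
  have [aZB sZB ZBB] := (is_cond_expP D_meas ZB sB).1 ceB.
  have mZB := summable_meas sZB.
  have [ZAB [ceAB _]] := cond_prob_exists P D_meas mAB.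
  have [aZAB sZAB ZABAB] := (is_cond_expP D_meas ZAB sAB).1 ceAB.
  have aeE := CI A B D1A D2B ZA ZB ZAB ceA ceB ceAB.
  have sZZ : summable P (fun w => ZA w * ZB w) by exact: summableMl mZA ZA1 sZB.
  have sZAB' : summable P (fun w => ZA w * \1_B w) by exact: summableM_indic.
  have e1 : Ex P \1_(A `&` B) = Ex P ZAB.
    apply/eqP; rewrite -subr_eq0 -ExB//.
    have := ZABAB _ (@measurableT _ (g_sigma_algebraType D)).
    by under eq_Ex do rewrite indicT mulr1; move=> ->.
  have e2 : Ex P ZAB = Ex P (fun w => ZA w * ZB w).
    apply: eq_ae_Ex aeE; first exact: summable_meas sZAB.
    exact: summable_meas sZZ.
  have e3 : Ex P (fun w => ZA w * \1_B w) = Ex P (fun w => ZA w * ZB w).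
    apply/eqP; rewrite -subr_eq0 -ExB//.
    rewrite -(null_on_adapted D_meas (summableB sB sZB) ZBB aZA).
      by apply/eqP/eq_Ex => w; ring.
    exact: summableMr mZA ZA1 (summableB sB sZB).
  rewrite -[RHS](subrr (Ex P ZAB)) -{1}e1 e2 -e3 -ExB//.
  by apply: eq_Ex => w; rewrite mulrBl indicI.
have syl := summableB sy sl.
have sAy : summable P (fun w => \1_A w * y w).
  by apply: (@summableMl _ _ _ _ \1_A y 1) => //; exact: normr_indic_le1.
have sZy : summable P (fun w => ZA w * y w) by exact: summableMl mZA ZA1 sy.
have sZl : summable P (fun w => ZA w * l w) by exact: summableMl mZA ZA1 sl.
have sAl : summable P (fun w => \1_A w * l w).
  by apply: (@summableMl _ _ _ _ \1_A l 1) => //; exact: normr_indic_le1.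
(* [E[1_A y] = E[ZA y] = E[ZA l] = E[1_A l]] *)
have h1 : Ex P (fun w => (\1_A w - ZA w) * y w) = 0.
  apply: (null_on_adapted D2_meas (summableB sA sZA) A_ZA ay).
  by under eq_fun do rewrite mulrBl; exact: summableB.
have h2 : Ex P (fun w => (y w - l w) * ZA w) = 0.
  apply: (null_on_adapted D_meas syl yl aZA).
  exact: summableMr mZA ZA1 syl.
have h3 : Ex P (fun w => (\1_A w - ZA w) * l w) = 0.
  apply: (null_on_adapted D_meas (summableB sA sZA) ZAA al).
  by under eq_fun do rewrite mulrBl; exact: summableB.
have s1 : summable P (fun w => (\1_A w - ZA w) * y w).
  by under eq_fun do rewrite mulrBl; exact: summableB.
have s2 : summable P (fun w => (\1_A w - ZA w) * l w).
  by under eq_fun do rewrite mulrBl; exact: summableB.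
have s3 : summable P (fun w => (y w - l w) * ZA w) by exact: summableMr mZA ZA1 syl.
transitivity (Ex P (fun w => ((\1_A w - ZA w) * y w + (y w - l w) * ZA w) -
    (\1_A w - ZA w) * l w)).
  by apply: eq_Ex => w; ring.
by rewrite ExB ?ExD ?h1 ?h2 ?h3 ?addr0 ?subr0//; exact: summableD.
Qed.

End conditional_independence.

(** * The state-space model *)

Section random_vectors.
Context {d : measure_display} {Omega : measurableType d} {R : realType}.
Variable P : probability Omega R.

(** The generators inside [sigma_rv]: [<<s rv_gen X>>] unfolds to [sigma_rv X], in the form that
    [adapted] and [null_on] expect. *)
Definition rv_gen {n} (X : Omega -> 'cV[R]_n) : set (set Omega) :=
  \bigcup_(i in [set: 'I_n]) preimage_set_system setT (rcoord X i) measurable.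

Definition linform {n} (a : 'cV[R]_n) (X : Omega -> 'cV[R]_n) : Omega -> R :=
  fun w => (a^T *m X w) 0 0.

Definition covform {n} (S : 'M[R]_n) (a b : 'cV[R]_n) : R := (a^T *m S *m b) 0 0.

Lemma linformE n (a : 'cV[R]_n) (X : Omega -> 'cV[R]_n) w :
  linform a X w = \sum_i a i 0 * rcoord X i w.
Proof. by rewrite /linform mxE; apply: eq_bigr => i _; rewrite mxE. Qed.

Lemma rv_gen_meas n (X : Omega -> 'cV[R]_n) : rvec X -> rv_gen X `<=` measurable.
Proof. by move=> mX A [i _ [B mB <-]]; exact: mX. Qed.

Lemma linform_adapted n (a : 'cV[R]_n) (X : Omega -> 'cV[R]_n) :
  adapted (rv_gen X) (linform a X).
Proof.
apply/adapted_measurable_fun.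
rewrite (_ : linform a X = fun w => \sum_i a i 0 * rcoord X i w); last first.
  by apply/funext => w; rewrite linformE.
apply: measurable_sum => i; apply: measurable_funM => //.
apply/adapted_measurable_fun => B mB; apply: sub_sigma_algebra.
by exists i => //; exists B => //; rewrite setTI.
Qed.

Lemma linform_meas n (a : 'cV[R]_n) (X : Omega -> 'cV[R]_n) : rvec X ->
  measurable_fun setT (linform a X).
Proof.
move=> rX; apply: (adapted_meas (rv_gen_meas rX)); exact: linform_adapted.
Qed.

Lemma covform_sym n (S : 'M[R]_n) a b : S^T = S -> covform S a b = covform S b a.
Proof. 
by move=> SS; rewrite /covform -[in LHS](trmxK (_ *m b)) mxE !trmx_mul trmxK SS mulmxA.
Qed.

Lemma covform_lin n (S : 'M[R]_n) c a b e :
  covform S (c *: a + b) e = c * covform S a e + covform S b e.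
Proof. by rewrite /covform linearP !mulmxDl -!scalemxAl !mxE. Qed.

Lemma linform_lin n c (a b : 'cV[R]_n) (X : Omega -> 'cV[R]_n) w :
  linform (c *: a + b) X w = c * linform a X w + linform b X w.
Proof. by rewrite /linform linearP !mulmxDl -!scalemxAl !mxE. Qed.

Lemma linformN n (a : 'cV[R]_n) (X : Omega -> 'cV[R]_n) w :
  linform (- a) X w = - linform a X w.
Proof. by rewrite /linform linearN mulNmx !mxE. Qed.

Lemma covform0l n (S : 'M[R]_n) b : covform S 0 b = 0.
Proof. by rewrite /covform trmx0 !mul0mx mxE. Qed.

Lemma linform0 n (X : Omega -> 'cV[R]_n) w : linform 0 X w = 0.
Proof. by rewrite /linform trmx0 mul0mx mxE. Qed.

(** The sine integral vanishes because the law is also prescribed for [- a], with the same variance.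
    Variance 0 is treated separately, with the Dirac law in place of a density. *)
Lemma gaussian0_linform n (X : Omega -> 'cV[R]_n) S a : rvec X -> gaussian0 P X S ->
  [/\ summable P (fun w => linform a X w ^+ 2),
      Ex P (fun w => cos (linform a X w)) = expR (- (covform S a a / 2)) &
      Ex P (fun w => sin (linform a X w)) = 0].
Proof.
move=> mX [_ gX].
set s := covform S a a; have [s0 law] := gX a.
have [_ lawN] := gX (- a).
have mL : measurable_fun setT (linform a X) by exact: linform_meas.
have mLN : measurable_fun setT (linform (- a) X) by exact: linform_meas.
have covN : ((- a)^T *m S *m (- a)) 0 0 = s.
  by rewrite [(- a)^T]linearN !mulNmx mulmxN opprK.
rewrite /= covN in lawN; rewrite -/(covform S a a) -/s in s0 law.
have msin : measurable_fun setT (@sin R).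
  by apply: continuous_measurable_fun; exact: continuous_sin.
have mcos : measurable_fun setT (@cos R).
  by apply: continuous_measurable_fun; exact: continuous_cos.
have msqr : measurable_fun setT (fun x : R => x ^+ 2).
  by apply: continuous_measurable_fun; exact: exprn_continuous.
have sinE (nu : probability (measurableTypeR R) R) :
    (forall B : set R, measurable B -> P (linform a X @^-1` B) = nu B) ->
    (forall B : set R, measurable B -> P (linform (- a) X @^-1` B) = nu B) ->
    Ex P (fun w => sin (linform a X w)) = 0.
  move=> h1 h2; have ss : summable nu (@sin R).
    by apply: (@summable_bounded _ _ _ _ _ 1) => // x; exact: sin_max.
  have [s1 e1] := summable_law mL h1 ss; have [_ e2] := summable_law mLN h2 ss.
  have : Ex P (sin \o linform (- a) X) = - Ex P (sin \o linform a X).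
    rewrite -mulN1r -ExZ//; apply: eq_Ex => w /=.
    by rewrite linformN sinN mulN1r.
  by rewrite e2 -e1 /comp; lra.
have [sz|sz] := eqVneq s 0.
  have d1 (B : set R) : measurable B -> P (linform a X @^-1` B) = \d_(0:R) B.
    by move=> /law; rewrite sz eqxx.
  have d2 (B : set R) : measurable B -> P (linform (- a) X @^-1` B) = \d_(0:R) B.
    by move=> /lawN; rewrite sz eqxx.
  pose dl : probability (measurableTypeR R) R := \d_(0 : measurableTypeR R).
  have dirac_sum (f : R -> R) : measurable_fun setT f ->
      summable dl f /\
      Ex dl f = f 0.
    move=> mf; split.
      apply/integrableP; split; first exact/measurable_EFinP.
      rewrite integral_dirac// ?diracT ?mul1e ?ltry//.
      by do 2 apply: measurableT_comp => //.
    rewrite /Ex /Rintegral integral_dirac// ?diracT ?mul1e//.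
    exact/measurable_EFinP.
  split; last exact: (sinE dl d1 d2).
    by have [h _] := summable_law (nu := dl) mL d1 (dirac_sum _ msqr).1.
  have [_ ->] := summable_law (nu := dl) mL d1 (dirac_sum _ mcos).1.
  by rewrite (dirac_sum _ mcos).2 cos0 sz mul0r oppr0 expR0.
pose sd := Num.sqrt s.
have sd0 : sd != 0 by rewrite gt_eqF// sqrtr_gt0 lt_neqAle eq_sym sz.
pose nd : probability (measurableTypeR R) R := normal_prob 0 sd.
have d1 (B : set R) : measurable B -> P (linform a X @^-1` B) = normal_prob 0 sd B.
  by move=> /law; rewrite (negbTE sz).
have d2 (B : set R) : measurable B -> P (linform (- a) X @^-1` B) = normal_prob 0 sd B.
  by move=> /lawN; rewrite (negbTE sz).
split; last exact: (sinE nd d1 d2).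
  by have [h _] := summable_law (nu := nd) mL d1 (summable_normal_sqr sd0).
have sc : summable (normal_prob 0 sd) (@cos R).
  by apply: (@summable_bounded _ _ _ _ _ 1) => // x; exact: cos_max.
have [_ ->] := summable_law (nu := nd) mL d1 sc.
by rewrite normal_chf_cos// sqr_sqrtr.
Qed.

End random_vectors.

Section state_space.
Context {d : measure_display} {Omega : measurableType d} {R : realType}.
Variables (P : probability Omega R) (T nx ny : nat).
Variables (A : nat -> 'M[R]_nx) (C : nat -> 'M[R]_(ny, nx)).
Variables (Q : nat -> 'M[R]_nx) (Rn : nat -> 'M[R]_ny) (P0 : 'M[R]_nx).
Variables (x q : nat -> Omega -> 'cV[R]_nx) (y r : nat -> Omega -> 'cV[R]_ny).
Hypothesis Hx : forall k, (1 <= k <= T)%N -> forall w, x k w = A k *m x k.-1 w + q k w.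
Hypothesis Hy : forall k, (k <= T)%N -> forall w, y k w = C k *m x k w + r k w.
Hypothesis Hx0m : rvec (x 0%N).
Hypothesis Hx0 : gaussian0 P (x 0%N) P0.
Hypothesis Hqm : forall k, (1 <= k <= T)%N -> rvec (q k).
Hypothesis Hq : forall k, (1 <= k <= T)%N -> gaussian0 P (q k) (Q k).
Hypothesis Hrm : forall k, (k <= T)%N -> rvec (r k).
Hypothesis Hr : forall k, (k <= T)%N -> gaussian0 P (r k) (Rn k).

(** Formal coefficients rather than random variables: the covariance form is then an explicit matrix
    expression, and its bilinearity and sign need no integration. *)
Definition coefs : lmodType R := ('M[R]_(nx, T.+1) * 'M[R]_(ny, T.+1))%type.
Implicit Types u v z : coefs.

(* Column [k] of [v.1] is applied to [x_0] ([k = 0]) or [q_k], that of [v.2] to [r_k]. *)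
Definition noise_term v (p : nat * nat) : Omega -> R :=
  match p.1 with
  | 0%N => linform (col ord0 v.1) (x 0%N)
  | 1%N => linform (col (inord p.2) v.1) (q p.2)
  | _ => linform (col (inord p.2) v.2) (r p.2)
  end.

Definition noise_cov u v (p : nat * nat) : R :=
  match p.1 with
  | 0%N => covform P0 (col ord0 u.1) (col ord0 v.1)
  | 1%N => covform (Q p.2) (col (inord p.2) u.1) (col (inord p.2) v.1)
  | _ => covform (Rn p.2) (col (inord p.2) u.2) (col (inord p.2) v.2)
  end.

Definition noise_gen (p : nat * nat) : set (set Omega) :=
  match p.1 with
  | 0%N => rv_gen (x 0%N)
  | 1%N => rv_gen (q p.2)
  | _ => rv_gen (r p.2)
  end.

Hypothesis Hind : mutually_independent P (noise_index T) (fun p => <<s noise_gen p>>).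

Definition noises : seq (nat * nat) := (0%N, 0%N) ::
  [seq (1%N, k) | k <- iota 1 T] ++ [seq (2%N, k) | k <- iota 0 T.+1].

Lemma noisesP p : p \in noises ->
  [\/ p = (0%N, 0%N), exists2 k, (1 <= k <= T)%N & p = (1%N, k) |
      exists2 k, (k <= T)%N & p = (2%N, k)].
Proof.
rewrite inE mem_cat => /or3P[/eqP ->|/mapP[k]|/mapP[k]].
- by apply: Or31.
- by rewrite mem_iota add1n ltnS => kT ->; apply: Or32; exists k.
- by rewrite mem_iota add0n ltnS => kT ->; apply: Or33; exists k.
Qed.

Lemma mem_noises1 k : (1 <= k <= T)%N -> (1%N, k) \in noises.
Proof.
move=> kT; rewrite inE mem_cat; apply/or3P/Or32.
by apply/mapP; exists k => //; rewrite mem_iota add1n ltnS.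
Qed.

Lemma mem_noises2 k : (k <= T)%N -> (2%N, k) \in noises.
Proof.
move=> kT; rewrite inE mem_cat; apply/or3P/Or33.
by apply/mapP; exists k => //; rewrite mem_iota add0n ltnS.
Qed.

Lemma noises_index p : p \in noises -> noise_index T p.
Proof.
move=> /noisesP[->|[k kT ->]|[k kT ->]]; first by left.
  by right; left.
by right; right.
Qed.

Lemma uniq_noises : uniq noises.
Proof.
rewrite /noises cons_uniq cat_uniq !map_inj_uniq ?iota_uniq ?andbT;
  try by move=> ? ? [].
apply/andP; split.
  by rewrite mem_cat; apply/norP; split; apply/negP => /mapP[].
by apply/hasPn => _ /mapP[k _ ->]; apply/negP => /mapP[].
Qed.

Definition ev v : Omega -> R := fun w => \sum_(p <- noises) noise_term v p w.
Definition cov u v : R := \sum_(p <- noises) noise_cov u v p.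

Lemma noise_gen_meas p : noise_index T p -> noise_gen p `<=` measurable.
Proof.
case: p => i k [[-> ->]|[/= [-> kT]|/= [-> kT]]]; apply: rv_gen_meas => //.
- exact: Hqm.
- exact: Hrm.
Qed.

Lemma noise_term_adapted v p : adapted (noise_gen p) (noise_term v p).
Proof. by case: p => [[|[|i]] k]; exact: linform_adapted. Qed.

Lemma noise_term_gaussian v p : p \in noises ->
  [/\ summable P (fun w => noise_term v p w ^+ 2),
      Ex P (fun w => cos (noise_term v p w)) = expR (- (noise_cov v v p / 2)) &
      Ex P (fun w => sin (noise_term v p w)) = 0].
Proof.
move=> /noisesP[->|[k kT ->]|[k kT ->]]; rewrite /noise_term /noise_cov /=.
- exact: (gaussian0_linform (col ord0 v.1) Hx0m Hx0).
- exact: (gaussian0_linform (col (inord k) v.1) (Hqm kT) (Hq kT)).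
- exact: (gaussian0_linform (col (inord k) v.2) (Hrm kT) (Hr kT)).
Qed.

Lemma cov_sym u v : cov u v = cov v u.
Proof.
apply: eq_big_seq => p /noisesP[->|[k kT ->]|[k kT ->]];
  rewrite /noise_cov /=; apply: covform_sym.
- by case: Hx0.
- by case: (Hq kT).
- by case: (Hr kT).
Qed.

Lemma cov_lin c u v z : cov (c *: u + v) z = c * cov u z + cov v z.
Proof.
rewrite /cov mulr_sumr -big_split; apply: eq_bigr => -[[|[|i]] k] _ /=;
  by rewrite /noise_cov /= linearP covform_lin.
Qed.

Lemma cov_ge0 v : 0 <= cov v v.
Proof.
rewrite /cov big_seq; apply: sumr_ge0 => p /noisesP[->|[k kT ->]|[k kT ->]];
  rewrite /noise_cov /covform /=.
- by have [_ /(_ (col ord0 v.1))[]] := Hx0.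
- by have [_ /(_ (col (inord k) v.1))[]] := Hq kT.
- by have [_ /(_ (col (inord k) v.2))[]] := Hr kT.
Qed.

Lemma ev_lin c u v w : ev (c *: u + v) w = c * ev u w + ev v w.
Proof.
rewrite /ev mulr_sumr -big_split; apply: eq_bigr => -[[|[|i]] k] _ /=;
  by rewrite /noise_term /= linearP linform_lin.
Qed.

Lemma noise_term_meas v p : p \in noises -> measurable_fun setT (noise_term v p).
Proof.
move=> pn; apply: (adapted_meas (noise_gen_meas (noises_index pn))).
exact: noise_term_adapted.
Qed.

Lemma ev_meas v : measurable_fun setT (ev v).
Proof. by apply: measurable_sum_seq => p; exact: noise_term_meas. Qed.

Lemma ev_sqr v : summable P (fun w => ev v w ^+ 2).
Proof.
rewrite /ev; have : {subset noises <= noises} by [].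
(* Only the summation list and the left side of the inclusion are generalized, so each term is still
   known to come from [noises]. *)
elim: {1 3}noises => [_|p s IH ps].
  by under eq_fun do rewrite big_nil; exact: summable_cst.
have pn : p \in noises by apply: ps; rewrite mem_head.
have sn : {subset s <= noises} by move=> p' p's; apply: ps; rewrite inE p's orbT.
under eq_fun do rewrite big_cons.
have [sp _ _] := noise_term_gaussian v pn; have ss := IH sn.
apply: (le_summable _ (summableD (summableZ 2 sp) (summableZ 2 ss))).
  apply: measurable_funX; apply: measurable_funD; first exact: noise_term_meas.
  by apply: measurable_sum_seq => p' /sn; exact: noise_term_meas.
move=> w; rewrite !ger0_norm ?sqr_ge0//; last first.
  by rewrite addr_ge0// mulr_ge0// sqr_ge0.
by have := sqr_ge0 (noise_term v p w - \sum_(i <- s) noise_term v i w); nra.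
Qed.

Lemma ev_cos_sin v : Ex P (fun w => cos (ev v w)) = expR (- (cov v v / 2)) /\
  Ex P (fun w => sin (ev v w)) = 0.
Proof.
have [||||-> ->] := @Ex_trig_sum_indep _ _ _ P _ (noise_index T) noise_gen
  noise_gen_meas Hind noises (noise_term v).
- exact: uniq_noises.
- exact: noises_index.
- by move=> p _; exact: noise_term_adapted.
- by move=> p pn; case: (noise_term_gaussian v pn).
split=> //; rewrite /cov.
rewrite (eq_big_seq (fun p => expR (- (noise_cov v v p / 2)))); last first.
  by move=> p pn; case: (noise_term_gaussian v pn).
rewrite -expR_sum mulr_suml -sumrN.
by [].
Qed.

Lemma ev_single v p0 w : p0 \in noises ->
  (forall p, p \in noises -> p != p0 -> noise_term v p w = 0) ->
  ev v w = noise_term v p0 w.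
Proof.
move=> p0n v0; rewrite /ev (bigD1_seq p0)//=; last exact: uniq_noises.
rewrite big1_seq ?addr0// => p /andP[pp0 pn]; exact: v0.
Qed.


Lemma ev_sum (I : Type) (s : seq I) (F : I -> coefs) w :
  ev (\sum_(i <- s) F i) w = \sum_(i <- s) ev (F i) w.
Proof.
elim: s => [|i s IH]; first by rewrite !big_nil (ev0 ev_lin).
by rewrite !big_cons (evD ev_lin) IH.
Qed.

Lemma col_delta n m' (i : 'I_n) (j j' : 'I_m') :
  col j' (delta_mx i j : 'M[R]_(n, m')) = if j' == j then delta_mx i 0 else 0.
Proof.
apply/matrixP => a b; rewrite !mxE (ord1 b); case: (j' == j); rewrite !mxE ?andbT//.
by rewrite andbF.
Qed.

Lemma linform_delta n (i : 'I_n) (X : Omega -> 'cV[R]_n) w :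
  linform (delta_mx i 0) X w = X w i 0.
Proof.
rewrite linformE (bigD1 i)//= mxE !eqxx mul1r big1 ?addr0// => j ji.
by rewrite mxE (negbTE ji) mul0r.
Qed.

Lemma inord_eq k k' : (k <= T)%N -> (k' <= T)%N ->
  (inord k == inord k' :> 'I_T.+1) = (k == k').
Proof. by move=> kT kT'; rewrite -val_eqE /= !inordK. Qed.

Definition state_noise k (i : 'I_nx) : coefs := (delta_mx i (inord k), 0).
Definition obs_noise k (j : 'I_ny) : coefs := (0, delta_mx j (inord k)).

Lemma inord0 : inord 0 = ord0 :> 'I_T.+1.
Proof. by apply/val_inj; rewrite /= inordK. Qed.

Lemma ev_initial i w : ev (state_noise 0 i) w = x 0%N w i 0.
Proof.
rewrite (@ev_single _ (0%N, 0%N)) => [|//|p].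
  by rewrite /noise_term/= inord0 col_delta eqxx linform_delta.
move=> /noisesP[->|[k kT ->]|[k kT ->]]; rewrite ?eqxx// => _.
  rewrite /noise_term/= col_delta inord_eq//; last by case/andP: kT.
  by case: k kT => // k _ /=; rewrite linform0.
by rewrite /noise_term/= linear0 linform0.
Qed.

Lemma ev_state_noise k i w : (1 <= k <= T)%N -> ev (state_noise k i) w = q k w i 0.
Proof.
move=> kT; have /andP[k1 k2] := kT; rewrite (ev_single (mem_noises1 kT)).
  by rewrite /noise_term/= col_delta eqxx linform_delta.
move=> p /noisesP[->|[k' kT' ->]|[k' kT' ->]] => [_|kk'|_].
- rewrite /noise_term/= -inord0 col_delta inord_eq//.
  by case: k kT k1 k2 => // k' _ _ _; rewrite linform0.
- rewrite /noise_term/= col_delta inord_eq//; last by case/andP: kT'.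
  case: eqP => [kE|]; last by rewrite linform0.
  by rewrite kE eqxx in kk'.
- by rewrite /noise_term/= linear0 linform0.
Qed.

Lemma ev_obs_noise k j w : (k <= T)%N -> ev (obs_noise k j) w = r k w j 0.
Proof.
move=> kT; rewrite (ev_single (mem_noises2 kT)).
  by rewrite /noise_term/= col_delta eqxx linform_delta.
move=> p /noisesP[->|[k' kT' ->]|[k' kT' ->]] => [_|_|kk'].
- by rewrite /noise_term/= linear0 linform0.
- by rewrite /noise_term/= linear0 linform0.
- rewrite /noise_term/= col_delta inord_eq//.
  case: eqP => [kE|]; last by rewrite linform0.
  by rewrite kE eqxx in kk'.
Qed.

(** Applied with [v] an observation made before time [k]: the fresh noise [r_k] is orthogonal to the
    past. *)
Lemma cov_obs_noise k j v : (k <= T)%N -> col (inord k) v.2 = 0 ->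
  cov (obs_noise k j) v = 0.
Proof.
move=> kT vk; rewrite /cov big1_seq// => p /=.
move=> /noisesP[->|[k' kT' ->]|[k' kT' ->]]; rewrite /noise_cov/=.
- by rewrite linear0 covform0l.
- by rewrite linear0 covform0l.
- rewrite col_delta inord_eq//; case: eqP => [->|_]; last by rewrite covform0l.
  by rewrite vk /covform mulmx0 mxE.
Qed.

(** The clause [v.2 = 0], that states contain no observation noise, is carried along because the
    orthogonality of [r_N] to earlier observations rests on it. *)
Lemma state_coefs k : (k <= T)%N -> forall i : 'I_nx,
  exists v, v.2 = 0 /\ forall w, x k w i 0 = ev v w.
Proof.
elim: k => [_ i|k IH kT i].
  by exists (state_noise 0 i); split=> // w; rewrite ev_initial.
have /choice[F FP] := IH (ltnW kT).
exists (\sum_j A k.+1 i j *: F j + state_noise k.+1 i); split.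
  rewrite /= addr0; have : is_submod [set v : coefs | v.2 = 0].
    by split=> // c u v /= -> ->; rewrite scaler0 addr0.
  move=> /(@submod_sum _ _ _ _ (index_enum 'I_nx) (fun j => A k.+1 i j *: F j)); apply.
  by move=> j /=; rewrite (FP j).1 scaler0.
move=> w; rewrite (@Hx k.+1 kT) /= !mxE (evD ev_lin) ev_sum ev_state_noise//; congr (_ + _).
by apply: eq_bigr => j _; rewrite (evZ ev_lin) (FP j).2.
Qed.

(** Choice turns the existence statement into a function of [k] and [i]; the default 0 can occur
    only for [k > T]. *)
Definition state_vec : nat -> 'I_nx -> coefs := fun k i =>
  xget 0 [set v | v.2 = 0 /\ forall w, x k w i 0 = ev v w].

Lemma state_vecP k i : (k <= T)%N ->
  (state_vec k i).2 = 0 /\ forall w, x k w i 0 = ev (state_vec k i) w.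
Proof.
move=> kT; have [v vP] := state_coefs kT i.
have := @xgetPex _ (0 : coefs) [set v | v.2 = 0 /\ forall w, x k w i 0 = ev v w].
by apply; exists v.
Qed.

Definition obs_vec k (j : 'I_ny) : coefs :=
  obs_noise k j + \sum_i C k j i *: state_vec k i.

Lemma ev_obs_vec k j : (k <= T)%N -> ev (obs_vec k j) = rcoord (y k) j.
Proof.
move=> kT; apply/funext => w; rewrite /rcoord Hy// !mxE (evD ev_lin) ev_sum.
rewrite ev_obs_noise// addrC; congr (_ + _); apply: eq_bigr => i _.
by rewrite (evZ ev_lin) (state_vecP i kT).2.
Qed.

Definition past k : seq coefs := [seq obs_vec l j | l <- iota 0 k.+1, j <- enum 'I_ny].

Lemma pastP k v : v \in past k -> exists l j, (l <= k)%N /\ v = obs_vec l j.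
Proof.
move=> /allpairsP[[l j] [lk _ ->]]; exists l, j; split=> //.
by move: lk; rewrite mem_iota add0n ltnS.
Qed.

Lemma mem_past k l j : (l <= k)%N -> obs_vec l j \in past k.
Proof.
by move=> lk; apply: allpairs_f; rewrite ?mem_iota ?add0n ?ltnS ?mem_enum.
Qed.

Definition past_gen k : set (set Omega) := \bigcup_(j in [set j | (j <= k)%N])
  \bigcup_(i in [set: 'I_ny]) preimage_set_system setT (rcoord (y j) i) measurable.

Lemma past_gen_meas k : (k <= T)%N -> past_gen k `<=` measurable.
Proof.
move=> kT S [l /= lk [j _ [E mE <-]]]; rewrite -ev_obs_vec ?(leq_trans lk)//.
exact: ev_meas.
Qed.

Lemma past_adapted k v : (k <= T)%N -> spanned [set` past k] v ->
  adapted (past_gen k) (ev v).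
Proof.
move=> kT sv; apply: (sv [set u | adapted (past_gen k) (ev u)]) => [|b /= /pastP[l [j [lk ->]]]].
  split=> [|c u z]; rewrite /=.
    rewrite (_ : ev 0 = fun=> 0); last by apply/funext => w; rewrite (ev0 ev_lin).
    apply/adapted_measurable_fun; exact: measurable_cst.
  move=> /adapted_measurable_fun mu /adapted_measurable_fun mz.
  rewrite (_ : ev _ = fun w => c * ev u w + ev z w); last first.
    by apply/funext => w; rewrite ev_lin.
  by apply/adapted_measurable_fun; apply: measurable_funD => //; exact: measurable_funM.
rewrite ev_obs_vec ?(leq_trans lk)// => E mE; apply: sub_sigma_algebra.
by exists l => //; exists j => //; exists E => //; rewrite setTI.
Qed.

Lemma past_null_on k z : (k <= T)%N -> (forall b, b \in past k -> cov z b = 0) ->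
  null_on P (past_gen k) (ev z).
Proof.
move=> kT zb; apply: (@orthogonal_null_on _ _ _ _ _ ev cov).
- exact: cov_sym.
- exact: cov_lin.
- exact: ev_lin.
- exact: ev_meas.
- exact: ev_sqr.
- by move=> v; case: (ev_cos_sin v).
- by move=> v; case: (ev_cos_sin v).
move=> S [l /= lk [j _ SE]]; exists (obs_vec l j) => /=.
  by apply: zb; exact: mem_past.
by rewrite ev_obs_vec ?(leq_trans lk).
Qed.

Lemma past_projection k u : exists2 l, spanned [set` past k] l &
  forall b, b \in past k -> cov (u - l) b = 0.
Proof. exact: (orthogonal_projection cov_sym cov_lin cov_ge0). Qed.

Lemma projection_cond_exp k u l : (k <= T)%N -> spanned [set` past k] l ->
  (forall b, b \in past k -> cov (u - l) b = 0) ->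
  is_cond_exp P <<s past_gen k>> (ev u) (ev l).
Proof.
move=> kT sl ul; apply/is_cond_expP; [exact: past_gen_meas|exact: ev_summable ev_meas ev_sqr _|].
split; [exact: past_adapted|exact: ev_summable ev_meas ev_sqr _|].
rewrite (_ : (fun w => _) = ev (u - l)); first exact: past_null_on.
by apply/funext => w; rewrite (evB ev_lin).
Qed.

Lemma summable_mul_ev (f : Omega -> R) v : measurable_fun setT f ->
  summable P (fun w => f w ^+ 2) -> summable P (fun w => f w * ev v w).
Proof. by move=> mf sf; apply: summable_mul => //; [exact: ev_meas|exact: ev_sqr]. Qed.

(* Only the marginal conditional independences are available.  They give
   [E[f ev v] = E[f ev l]] for [v] an observation and [l] its projection on the
   past, an identity which is linear in [v]. *)
Lemma Ex_mul_orthogonal (D : set (set Omega)) (f : Omega -> R) k N z :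
  D `<=` measurable -> adapted D f -> summable P (fun w => f w ^+ 2) ->
  (forall l, (k < l <= T)%N ->
    cond_indep P <<s D>> <<s rv_gen (y l)>> <<s past_gen k>>) ->
  (k <= N <= T)%N -> spanned [set` past N] z ->
  (forall b, b \in past k -> cov z b = 0) ->
  Ex P (fun w => f w * ev z w) = 0.
Proof.
move=> mD af sf CI /andP[kN NT] sz zk; have kT := leq_trans kN NT.
have mf := adapted_meas mD af.
have sfe v : summable P (fun w => f w * ev v w) by exact: summable_mul_ev.
(* The projection is quantified existentially: a semidefinite form need not determine it, and a
   combination of projections is a projection of the combination, so [K] is a submodule. Membership
   need only be checked on observations; those up to time [k] are their own projections. *)
pose K : set coefs := [set v | exists l, [/\ spanned [set` past k] l,
  forall b, b \in past k -> cov (v - l) b = 0 &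
  Ex P (fun w => f w * ev (v - l) w) = 0]].
have sp := spanned_submod [set` past k].
have E0 v : v = 0 -> Ex P (fun w => f w * ev v w) = 0.
  by move=> ->; rewrite -[RHS](Ex0 P); apply: eq_Ex => w; rewrite (ev0 ev_lin) mulr0.
have sK : is_submod K.
  split.
    exists 0; split; [by case: sp| |by rewrite E0 ?subrr].
    by move=> b _; rewrite subrr (form0 cov_lin).
  move=> c u v [l [sl ul ul0]] [l' [sl' vl' vl0]].
  have E : c *: u + v - (c *: l + l') = c *: (u - l) + (v - l').
    by rewrite opprD addrACA scalerBr.
  exists (c *: l + l'); rewrite E; split.
  - by case: sp => _; apply.
  - by move=> b bk; rewrite cov_lin ul// vl'// mulr0 addr0.
  - transitivity (Ex P (fun w => c * (f w * ev (u - l) w) + f w * ev (v - l') w)).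
      by apply: eq_Ex => w; rewrite ev_lin; ring.
    by rewrite ExD ?ExZ ?ul0 ?vl0 ?mulr0 ?addr0//; exact: summableZ.
have [l [sl zl zl0]] : K z.
  apply: sz => // b /= /pastP[l [j [lN ->]]]; have lT := leq_trans lN NT.
  have [lk|kl] := leqP l k.
    exists (obs_vec l j); split; [|by move=> b' _; rewrite subrr (form0 cov_lin)|].
      by apply: sub_spanned; exact: mem_past.
    by rewrite E0 ?subrr.
  have [p sp' pP] := past_projection k (obs_vec l j).
  exists p; split=> //.
  have ce := projection_cond_exp kT sp' pP.
  have sev v : summable P (ev v) by exact: ev_summable ev_meas ev_sqr v.
  have my : rv_gen (y l) `<=` measurable.
    by apply: rv_gen_meas => i; rewrite -ev_obs_vec//; exact: ev_meas.
  have ay : adapted (rv_gen (y l)) (ev (obs_vec l j)).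
    rewrite ev_obs_vec// => B mB; apply: sub_sigma_algebra.
    by exists j => //; exists B => //; rewrite setTI.
  have klT : (k < l <= T)%N by rewrite kl.
  have h := cond_indep_null_on mD my (past_gen_meas kT) (CI l klT) (sev _) ay ce.
  transitivity (Ex P (fun w => (ev (obs_vec l j) w - ev p w) * f w)).
    by apply: eq_Ex => w; rewrite (evB ev_lin) mulrC.
  apply: (null_on_adapted mD _ h af); first exact: summableB.
  have := sfe (obs_vec l j - p).
  by under eq_fun do rewrite (evB ev_lin) mulrC.
(* [l = z - (z - l)] is orthogonal to the past and lies in its span, so [ev l] is both adapted and
   null, hence almost surely 0. *)
have lk b : b \in past k -> cov l b = 0.
  move=> bk; have := zl b bk; rewrite (formB cov_lin) zk// sub0r.
  by move=> /eqP; rewrite oppr_eq0 => /eqP.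
have l0 := null_on_adapted_ae0 (past_gen_meas kT)
  (ev_summable ev_meas ev_sqr l) (past_adapted kT sl) (past_null_on kT lk).
transitivity (Ex P (fun w => f w * ev (z - l) w + f w * ev l w)).
  by apply: eq_Ex => w; rewrite (evB ev_lin); ring.
rewrite ExD// zl0 add0r -[RHS](Ex0 P); apply: eq_ae_Ex => //.
  exact: summable_meas (sfe l).
by apply: filterS l0 => w ->; rewrite mulr0.
Qed.

(** [xhat] is an arbitrary version, so it equals the projection only almost surely; measurability of
    the innovation is therefore a separate clause. [1 <= N] makes [N.-1] a strictly earlier time. *)
Lemma innovation_coefs N (xhat : Omega -> 'cV[R]_nx) (j : 'I_ny) : (1 <= N <= T)%N ->
  is_cond_expv P <<s past_gen N.-1>> (x N) xhat ->
  exists z, [/\ spanned [set` past N] z,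
    forall b, b \in past N.-1 -> cov z b = 0,
    {ae P, forall w, innovation y C N xhat w j 0 = ev z w} &
    measurable_fun setT (fun w => innovation y C N xhat w j 0)].
Proof.
move=> /andP[N1 NT] xh; have N'T : (N.-1 <= T)%N by rewrite (leq_trans (leq_pred N)).
have mG := past_gen_meas N'T.
have sev v : summable P (ev v) by exact: ev_summable ev_meas ev_sqr v.
have /choice[l lP] : forall a, exists l, spanned [set` past N.-1] l /\
    forall b, b \in past N.-1 -> cov (state_vec N a - l) b = 0.
  by move=> a; have [l] := past_projection N.-1 (state_vec N a); exists l.
have xE a : rcoord (x N) a = ev (state_vec N a).
  by apply/funext => w; rewrite /rcoord (state_vecP a NT).2.
have xhP a : [/\ adapted (past_gen N.-1) (rcoord xhat a), summable P (rcoord xhat a) &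
    null_on P (past_gen N.-1) (fun w => ev (state_vec N a) w - rcoord xhat a w)].
  by apply/(is_cond_expP mG) => //; rewrite -xE; exact: xh.
have mxh a : measurable_fun setT (rcoord xhat a) by have [_ s _] := xhP a; exact: summable_meas s.
have xhl a : {ae P, forall w, rcoord xhat a w = ev (l a) w}.
  have [ax sx nx0] := xhP a; have [sl lo] := lP a.
  have [al sl' nl] := (is_cond_expP mG (ev (l a)) (sev _)).1 (projection_cond_exp N'T sl lo).
  have := @null_on_adapted_ae0 _ _ _ P _ (fun w => rcoord xhat a w - ev (l a) w) mG
    (summableB sx sl') (adaptedB ax al).
  (* Two versions of the same conditional expectation differ by an adapted null function, hence
     agree almost surely. *)
  move=> h; have : null_on P (past_gen N.-1) (fun w => rcoord xhat a w - ev (l a) w).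
    move=> S GS; have mS := sigma_meas mG GS.
    transitivity (Ex P (fun w => (ev (state_vec N a) w - ev (l a) w) * \1_S w -
        (ev (state_vec N a) w - rcoord xhat a w) * \1_S w)).
      by apply: eq_Ex => w; ring.
    rewrite ExB ?nl ?nx0 ?subrr//; apply: summableM_indic => //; exact: summableB.
  by move=> /h; apply: filterS => w /eqP; rewrite subr_eq0 => /eqP.
have innE w : innovation y C N xhat w j 0 =
    ev (obs_vec N j) w - \sum_a C N j a * rcoord xhat a w.
  by rewrite ev_obs_vec// /innovation !mxE; congr (_ - _).
exists (obs_vec N j - \sum_a C N j a *: l a); split.
- have sN := spanned_submod [set` past N]; apply: (submodB sN).
    by apply: sub_spanned; exact: mem_past.
  apply: (submod_sum _ sN) => a; apply: (submodZ _ sN).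
  apply: (@spannedS _ _ [set` past N.-1]); last exact: (lP a).1.
  by move=> b /= /pastP[i [i' [iN ->]]]; apply: mem_past; rewrite (leq_trans iN)// leq_pred.
- move=> b bN.
  (* The innovation is [r_N + C (x_N - l)]: the first term is orthogonal to the past as fresh noise,
     the second because each [l a] is a projection. *)
  have -> : obs_vec N j - \sum_a C N j a *: l a =
      obs_noise N j + \sum_a C N j a *: (state_vec N a - l a).
    rewrite /obs_vec -addrA; congr (_ + _); rewrite -sumrB.
    by apply: eq_bigr => a _; rewrite scalerBr.
  rewrite (formD cov_lin) cov_obs_noise// ?add0r.
    have os := orthogonal_submod cov_sym cov_lin b.
    rewrite cov_sym; apply: (submod_sum _ os) => a; apply: (submodZ _ os).
    by rewrite /= cov_sym (lP a).2.
  have [i [i' [iN ->]]] := pastP bN.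
  have iT : (i <= T)%N by exact: leq_trans iN N'T.
  have iN' : (i < N)%N by rewrite (leq_ltn_trans iN)// ltn_predL.
  have os : is_submod [set v : coefs | col (inord N) v.2 = 0].
    split=> [|c u v /=]; first by rewrite /= linear0.
    by move=> uE vE; rewrite linearP /= uE vE scaler0 addr0.
  apply: (submodD os).
    by rewrite /= col_delta inord_eq// gtn_eqF.
  apply: (submod_sum _ os) => a; apply: (submodZ _ os).
  by rewrite /= (state_vecP a iT).1 linear0.
(* There are finitely many coordinates, so their exceptional null sets can be merged. *)
- have : {ae P, forall w, forall a, rcoord xhat a w = ev (l a) w}.
    exact: filter_forall xhl.
  apply: filterS => w h; rewrite innE (evB ev_lin) ev_sum; congr (_ - _).
  by apply: eq_bigr => a _; rewrite (evZ ev_lin) h.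
- under eq_fun do rewrite innE; apply: measurable_funB; first exact: ev_meas.
  by apply: measurable_sum => a; exact: measurable_funM.
Qed.

End state_space.

Theorem theorem3 (d : measure_display) (Omega : measurableType d) (R : realType)
  (P : probability Omega R) (T nx ny m : nat)
  (A : nat -> 'M[R]_nx) (C : nat -> 'M[R]_(ny, nx))
  (Q : nat -> 'M[R]_nx) (Rn : nat -> 'M[R]_ny) (P0 : 'M[R]_nx)
  (x q : nat -> Omega -> 'cV[R]_nx) (y r : nat -> Omega -> 'cV[R]_ny)
  (J : nat -> Omega -> 'cV[R]_m)
  (* dynamics and observations *)
  (Hx : forall k, (1 <= k <= T)%N -> forall w, x k w = A k *m x k.-1 w + q k w)
  (Hy : forall k, (k <= T)%N -> forall w, y k w = C k *m x k w + r k w)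
  (* Gaussian noises and initial state *)
  (Hx0m : rvec (x 0%N)) (Hx0 : gaussian0 P (x 0%N) P0)
  (Hqm : forall k, (1 <= k <= T)%N -> rvec (q k))
  (Hq : forall k, (1 <= k <= T)%N -> gaussian0 P (q k) (Q k))
  (Hrm : forall k, (k <= T)%N -> rvec (r k))
  (Hr : forall k, (k <= T)%N -> gaussian0 P (r k) (Rn k))
  (* x_0, q_1..q_T, r_0..r_T mutually independent *)
  (Hind : mutually_independent P (noise_index T)
     (fun p => match p.1 with
               | 0%N => sigma_rv (x 0%N)
               | 1%N => sigma_rv (q p.2)
               | _ => sigma_rv (r p.2) end))
  (* J: random vectors with finite second moments *)
  (HJm : forall k, (k <= T)%N -> rvec (J k))
  (HJ2 : forall k, (k <= T)%N -> forall i,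
      P.-integrable setT (fun w => (rcoord (J k) i w ^+ 2)%:E))
  (* conditional independence of J_k and y_{k+n} given Y_0^k *)
  (HCI : forall k n, (1 <= n)%N -> (k + n <= T)%N ->
      cond_indep P (sigma_rv (J k)) (sigma_rv (y (k + n)%N)) (sigma_past y k)) :
  forall k n, (1 <= n)%N -> (k + n <= T)%N ->
  forall xhat : Omega -> 'cV[R]_nx,
    is_cond_expv P (sigma_past y (k + n).-1) (x (k + n)%N) xhat ->
    forall (i : 'I_m) (j : 'I_ny),
      expectation P (fun w => J k w i 0 * innovation y C (k + n)%N xhat w j 0) = 0%E.
Proof.
move=> k n n1 knT xhat xhatP i j; set N := (k + n)%N in knT xhatP *.
have kN : (k < N)%N by rewrite /N -[X in (X < _)%N]addn0 ltn_add2l.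
have N1 : (1 <= N <= T)%N by rewrite knT andbT (leq_ltn_trans _ kN).
have kN' : (k <= N.-1)%N by rewrite -ltnS prednK// (leq_ltn_trans _ kN).
have kT : (k <= T)%N by rewrite (leq_trans (ltnW kN)).
have indep : mutually_independent P (noise_index T)
    (fun p => <<s noise_gen x q r p>>).
  by move: Hind; congr mutually_independent; apply/funext => -[[|[|a]] b].
have [z [zN zpast inn_z minn]] :=
  innovation_coefs Hx Hy Hx0m Hx0 Hqm Hq Hrm Hr indep j N1 xhatP.
have mJ : rv_gen (J k) `<=` measurable by exact: rv_gen_meas (HJm k kT).
have aJ : adapted (rv_gen (J k)) (rcoord (J k) i).
  move=> B mB; apply: sub_sigma_algebra.
  by exists i => //; exists B => //; rewrite setTI.
have CI l : (k < l <= T)%N ->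
    cond_indep P <<s rv_gen (J k)>> <<s rv_gen (y l)>> <<s past_gen y k>>.
  move=> /andP[kl lT]; have := HCI k (l - k)%N.
  by rewrite subnKC ?(ltnW kl)// subn_gt0; apply.
have Jz : Ex P (fun w => rcoord (J k) i w * ev x q r z w) = 0.
  apply: (Ex_mul_orthogonal Hx Hy Hx0m Hx0 Hqm Hq Hrm Hr indep mJ aJ (HJ2 k kT i) CI _ zN).
    by rewrite (ltnW kN).
  (* Orthogonality is known up to time [N.-1] and needed only up to [k], which is at most [N.-1]
     since [n >= 1]. *)
  move=> b /pastP[l [l' [lk ->]]]; apply: zpast.
  by apply: mem_past; exact: leq_trans lk kN'.
have sJz := summable_mul_ev Hx0m Hx0 Hqm Hq Hrm Hr z (HJm k kT i) (HJ2 k kT i).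
rewrite unlock.
(* Replaces the given version of the innovation by its linear representative, for which the product
   with [J_k] is known to be integrable. *)
have -> : (\int[P]_w (J k w i 0 * innovation y C N xhat w j 0)%:E =
    \int[P]_w (rcoord (J k) i w * ev x q r z w)%:E)%E.
  apply: ae_eq_integral => //.
  - by apply/measurable_EFinP; apply: measurable_funM => //; exact: HJm.
  - by apply/measurable_EFinP; exact: summable_meas sJz.
  - by apply: filterS inn_z => w /= -> _.
by rewrite -[LHS]fineK ?[fine _]Jz//; exact: integrable_fin_num sJz.
Qed.
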